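(* Let $X$ be a real Banach space such that $X^*$ has the Radon–Nikodym property (in the sense below), and let $g:X^*\to(-\infty,+\infty]$ be a proper convex weak$^*$-lower semicontinuous function which is $w^*$-epi-pointed, i.e. $\operatorname{int}(\operatorname{dom}(g^*|_X))\ne\emptyset$. Let $x_0^*\in D(\partial g\cap X)$. Then for every $x^*\in X^*$, $$g(x^* )-g(x_0^* )=\sup\Big\{\sum_{i=0}^{n-1}\langle x_i,x_{i+1}^*-x_i^*\rangle+\langle x_n,x^*-x_n^*\rangle\Big\},$$ where the supremum is taken over all integers $n\ge0$, all $x_1^*,\dots,x_n^*\in w^*\text{-}\mathrm{exp}\,g$ and all $x_i\in\partial g(x_i^* )\cap X$ for $i=0,1,\dots,n$.
   Context: $X$ is identified with its canonical image in $X^{**}$; for $x^*\in\operatorname{dom} g=\{g<+\infty\}$, $\partial g(x^* )\cap X=\{x\in X:\langle y^*-x^*,x\rangle\le g(y^* )-g(x^* )\ \forall y^*\in X^*\}$, and $D(\partial g\cap X)=\{x^*:\partial g(x^* )\cap X\ne\emptyset\}$. $g^*|_X(x)=\sup_{x^*\in X^*}(\langle x^*,x\rangle-g(x^* ))$, interior in the norm topology of $X$. For a nonempty closed convex $C\subset X^*\times\mathbb{R}$ (dual of $X\times\mathbb{R}$) with $\sigma_C(u)=\sup_{c\in C}\langle c,u\rangle$, a point $c_0\in C$ is $w^*$-strongly exposed by $u\in X\times\mathbb{R}$ if for every sequence $(c_n)\subset C$, $\langle c_n,u\rangle\to\sigma_C(u)$ implies $c_n\to c_0$ in norm. $x^*\in\operatorname{dom}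 g$ belongs to $w^*\text{-}\mathrm{exp}\,g$ (is a $w^*$-strongly exposed point of $g$) if $(x^*,g(x^* ))$ is $w^*$-strongly exposed (by some element of $X\times\mathbb{R}$) in $\operatorname{epi} g=\{(y^*,r)\in X^*\times\mathbb{R}:r\ge g(y^* )\}$. $X^*$ has the Radon–Nikodym property if every nonempty weak$^*$-compact convex $K\subset X^*$ equals the weak$^*$-closed convex hull of its $w^*$-strongly exposed points (points $u^*\in K$ for which some $u\in X$ satisfies: $(u_n^* )\subset K$, $\langle u_n^*,u\rangle\to\sup_K u$ implies $u_n^*\to u^*$ in norm). *)

(* Defs.v *)
From Stdlib Require Import Reals List Classical.
Open Scope R_scope.

Record NormedSpace := {
  ns_car :> Type;
  ns_zero : ns_car;
  ns_add : ns_car -> ns_car -> ns_car;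
  ns_opp : ns_car -> ns_car;
  ns_scal : R -> ns_car -> ns_car;
  ns_norm : ns_car -> R;
  ns_add_assoc : forall x y z, ns_add x (ns_add y z) = ns_add (ns_add x y) z;
  ns_add_comm : forall x y, ns_add x y = ns_add y x;
  ns_add_zero : forall x, ns_add x ns_zero = x;
  ns_add_opp : forall x, ns_add x (ns_opp x) = ns_zero;
  ns_scal_one : forall x, ns_scal 1 x = x;
  ns_scal_assoc : forall a b x, ns_scal a (ns_scal b x) = ns_scal (a * b) x;
  ns_scal_distr_l : forall a x y,
      ns_scal a (ns_add x y) = ns_add (ns_scal a x) (ns_scal a y);
  ns_scal_distr_r : forall a b x,
      ns_scal (a + b) x = ns_add (ns_scal a x) (ns_scal b x);
  ns_norm_eq0 : forall x, ns_norm x = 0 -> x = ns_zero;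
  ns_norm_scal : forall a x, ns_norm (ns_scal a x) = Rabs a * ns_norm x;
  ns_norm_triangle : forall x y, ns_norm (ns_add x y) <= ns_norm x + ns_norm y
}.

Definition ns_sub (X : NormedSpace) (x y : X) : X := ns_add X x (ns_opp X y).

Definition Banach (X : NormedSpace) : Prop :=
  forall u : nat -> X,
    (forall eps, eps > 0 -> exists N, forall m n, (N <= m)%nat -> (N <= n)%nat ->
        ns_norm X (ns_sub X (u m) (u n)) < eps) ->
    exists l : X, forall eps, eps > 0 -> exists N, forall n, (N <= n)%nat ->
        ns_norm X (ns_sub X (u n) l) < eps.

Record Dual (X : NormedSpace) := {
  dual_fun :> X -> R;
  dual_add : forall x y, dual_fun (ns_add X x y) = dual_fun x + dual_fun y;
  dual_scal : forall a x, dual_fun (ns_scal X a x) = a * dual_fun x;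
  dual_bdd : exists M, forall x, Rabs (dual_fun x) <= M * ns_norm X x
}.
Arguments dual_fun {X} _ _.

Definition dual_norm_cv {X : NormedSpace} (c : nat -> Dual X) (c0 : Dual X) : Prop :=
  forall eps, eps > 0 -> exists N, forall n, (N <= n)%nat ->
    forall x : X, Rabs (c n x - c0 x) <= eps * ns_norm X x.

Inductive ERbar := ERfin (r : R) | ERinf.

Definition ER_le (a b : ERbar) : Prop :=
  match a, b with
  | ERfin x, ERfin y => x <= y
  | _, ERinf => True
  | ERinf, ERfin _ => False
  end.

Definition ER_minus (a : ERbar) (r : R) : ERbar :=
  match a with ERfin x => ERfin (x - r) | ERinf => ERinf end.

Definition is_sup_ER (P : R -> Prop) (s : ERbar) : Prop :=
  match s with
  | ERfin r => (forall v, P v -> v <= r) /\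
               (forall eps, eps > 0 -> exists v, P v /\ v > r - eps)
  | ERinf => forall M, exists v, P v /\ v > M
  end.

Definition cv_ER (u : nat -> R) (s : ERbar) : Prop :=
  match s with
  | ERfin l => Un_cv u l
  | ERinf => forall M, exists N, forall n, (N <= n)%nat -> u n > M
  end.

Definition wstar_open {X : NormedSpace} (U : Dual X -> Prop) : Prop :=
  forall u, U u -> exists (l : list X) (eps : R), eps > 0 /\
    forall v : Dual X, (forall x, In x l -> Rabs (v x - u x) < eps) -> U v.

Definition wstar_closed {X : NormedSpace} (C : Dual X -> Prop) : Prop :=
  wstar_open (fun v => ~ C v).

Definition wstar_compact {X : NormedSpace} (K : Dual X -> Prop) : Prop :=
  forall (I : Type) (U : I -> Dual X -> Prop),
    (forall i, wstar_open (U i)) ->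
    (forall y, K y -> exists i, U i y) ->
    exists l : list I, forall y, K y -> exists i, In i l /\ U i y.

Definition convex_set {X : NormedSpace} (K : Dual X -> Prop) : Prop :=
  forall (a b c : Dual X) (t : R), 0 <= t <= 1 -> K a -> K b ->
    (forall x, c x = t * a x + (1 - t) * b x) -> K c.

Definition wstar_cl_conv_hull {X : NormedSpace} (S : Dual X -> Prop) (y : Dual X) : Prop :=
  forall C : Dual X -> Prop, wstar_closed C -> convex_set C ->
    (forall z, S z -> C z) -> C y.

Definition wstar_strongly_exposed_pt {X : NormedSpace} (K : Dual X -> Prop) (us : Dual X) : Prop :=
  K us /\ exists u : X, forall sig : ERbar,
    is_sup_ER (fun v => exists y, K y /\ v = y u) sig ->
    forall seq : nat -> Dual X, (forall n, K (seq n)) ->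
      cv_ER (fun n => seq n u) sig -> dual_norm_cv seq us.

Definition RNP_dual (X : NormedSpace) : Prop :=
  forall K : Dual X -> Prop, (exists y, K y) -> wstar_compact K -> convex_set K ->
    forall y, K y <-> wstar_cl_conv_hull (wstar_strongly_exposed_pt K) y.

Definition proper_fun {X : NormedSpace} (g : Dual X -> ERbar) : Prop :=
  exists x, g x <> ERinf.

Definition convex_fun {X : NormedSpace} (g : Dual X -> ERbar) : Prop :=
  forall (a b c : Dual X) (t ra rb : R), 0 <= t <= 1 ->
    g a = ERfin ra -> g b = ERfin rb ->
    (forall x, c x = t * a x + (1 - t) * b x) ->
    ER_le (g c) (ERfin (t * ra + (1 - t) * rb)).

Definition wstar_lsc {X : NormedSpace} (g : Dual X -> ERbar) : Prop :=
  forall r, wstar_closed (fun v => ER_le (g v) (ERfin r)).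

Definition conj_dom {X : NormedSpace} (g : Dual X -> ERbar) (x : X) : Prop :=
  exists M, forall (xs : Dual X) (r : R), g xs = ERfin r -> xs x - r <= M.

Definition wstar_epi_pointed {X : NormedSpace} (g : Dual X -> ERbar) : Prop :=
  exists (x0 : X) (delta : R), delta > 0 /\
    forall y : X, ns_norm X (ns_sub X y x0) < delta -> conj_dom g y.

Definition subdiff_X {X : NormedSpace} (g : Dual X -> ERbar) (xs : Dual X) (x : X) : Prop :=
  exists r, g xs = ERfin r /\
    forall (ys : Dual X) (s : R), g ys = ERfin s -> ys x - xs x <= s - r.

Definition epi {X : NormedSpace} (g : Dual X -> ERbar) (ys : Dual X) (t : R) : Prop :=
  ER_le (g ys) (ERfin t).

(** xs in wstar-exp g: (xs, g xs) is wstar-strongly exposed in epi g by some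
    (x, s) in X x R; pairing of (y,t) with (x,s) is y x + t s; norm convergence
    in the product is componentwise. *)
Definition wstar_exp {X : NormedSpace} (g : Dual X -> ERbar) (xs : Dual X) : Prop :=
  exists r, g xs = ERfin r /\
  exists (x : X) (s : R), forall sig : ERbar,
    is_sup_ER (fun v => exists ys t, epi g ys t /\ v = ys x + t * s) sig ->
    forall (ys : nat -> Dual X) (ts : nat -> R), (forall n, epi g (ys n) (ts n)) ->
      cv_ER (fun n => ys n x + ts n * s) sig ->
      dual_norm_cv ys xs /\ Un_cv ts r.

Fixpoint chain_psum {X : NormedSpace} (xss : nat -> Dual X) (ys : nat -> X) (n : nat) : R :=
  match n with
  | O => 0
  | S k => chain_psum xss ys k + (xss (S k) (ys k) - xss k (ys k))
  end.

Definition chain_value {X : NormedSpace} (xss : nat -> Dual X) (ys : nat -> X)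
    (n : nat) (xs : Dual X) : R :=
  chain_psum xss ys n + (xs (ys n) - xss n (ys n)).

(* Main.v *)
Require Import Defs.
From Stdlib Require Import Reals List Classical.
From Stdlib Require Import ClassicalEpsilon Lra Lia.
From mathcomp Require filter.
Import ListNotations.
Open Scope R_scope.

(** Let f be the restriction of g* to X. Each chain value is at most g(x* ) - g(x0* ) by adding
    up subgradient inequalities. Conversely, f is finite on a ball, hence bounded above on a
    smaller ball by Baire's theorem, and by convexity near every point of a half-open segment
    from a point x_0 of dom f to the centre b of such a ball. Near a point around which f is
    bounded above, subgradients exist and are bounded (Banach-Alaoglu); the Radon-Nikodym
    property makes the w*-slices of sets of subgradients small, so by Baire's theorem again f is
    Fréchet differentiable at a dense set of such points, and its derivatives there are w*-strongly
    exposed points of g. Choosing x_i such a point very close to x_0 + (i/N)(b - x_0), the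
    chain is a Riemann sum for f along the segment, and its value tends to
    <b,x*> - f(b) - g(x0* ). The supremum over b is g(x* ) - g(x0* ) by the
    w*-biconjugate theorem. *)

(** The obstacle is the initial point: x_0 may lie on the boundary of dom f, where f need not be
    bounded on any ball, so bounds on the subgradients along the segment may blow up as the mesh 1/N
    is refined. No modulus of continuity of f is therefore available. Expressed through f, an
    increment of the chain pairs x_(i+1)^* with the step x_(i+1) - x_i just made, for which the
    subgradient inequality points the wrong way; since the points x_0 + (i/N)(b - x_0) are equally
    spaced, this step can be exchanged for the next one. The increments of f then telescope, and
    what survives sits at the two ends: near x_0 it is controlled by x_0^* alone, near b by a local
    bound, and both errors are O(1/N) with constants fixed before N. The bound L on the intermediate
    subgradients depends on N, but is multiplied by the distance h of the x_i from the equally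
    spaced points, and density of the good points allows h to be chosen after N and L. *)

Local Notation "x [+] y" := (ns_add _ x y) (at level 50, left associativity).
Local Notation "x [-] y" := (ns_sub _ x y) (at level 50, left associativity).
Local Notation "a [*] x" := (ns_scal _ a x) (at level 40, left associativity).
Local Notation norm := (ns_norm _).

(** * Vector identities by reflection *)

Inductive vexpr :=
| VVar (n : nat)
| VAdd (a b : vexpr)
| VScal (r : R) (a : vexpr)
| VOpp (a : vexpr)
| VZero.

Fixpoint veval {X : NormedSpace} (env : nat -> X) (e : vexpr) : X :=
  match e with
  | VVar n => env n
  | VAdd a b => veval env a [+] veval env b
  | VScal r a => r [*] veval env a
  | VOpp a => ns_opp X (veval env a)
  | VZero => ns_zero X
  end.

Fixpoint vcoef (e : vexpr) (i : nat) : R :=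
  match e with
  | VVar n => if Nat.eqb n i then 1 else 0
  | VAdd a b => vcoef a i + vcoef b i
  | VScal r a => r * vcoef a i
  | VOpp a => - vcoef a i
  | VZero => 0
  end.

Fixpoint vbound (n : nat) (e : vexpr) : bool :=
  match e with
  | VVar i => Nat.ltb i n
  | VAdd a b => vbound n a && vbound n b
  | VScal _ a | VOpp a => vbound n a
  | VZero => true
  end.

Fixpoint vcomb {X : NormedSpace} (env : nat -> X) (n : nat) (c : nat -> R) : X :=
  match n with
  | O => ns_zero X
  | S k => vcomb env k c [+] c k [*] env k
  end.

(** A conjunction instead of a bounded quantifier: after computation, [vfield] splits it into one
    real identity per atom. *)
Fixpoint vcoef_agree (n : nat) (a b : vexpr) : Prop :=
  match n with
  | O => True
  | S k => vcoef_agree k a b /\ vcoef a k = vcoef b k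
  end.

Section LinearCombinations.

Context {X : NormedSpace}.
Implicit Types (x y z : X) (a b r : R).

Lemma add_zero_l x : ns_zero X [+] x = x.
Proof. rewrite ns_add_comm. apply ns_add_zero. Qed.

Lemma add_cancel_l x y z : x [+] y = x [+] z -> y = z.
Proof.
  intro H.
  rewrite <- (add_zero_l y), <- (add_zero_l z), <- (ns_add_opp X x), (ns_add_comm X x).
  rewrite <- !ns_add_assoc, H. reflexivity.
Qed.

Lemma scal_zero_l x : 0 [*] x = ns_zero X.
Proof.
  apply (add_cancel_l (0 [*] x)).
  rewrite <- ns_scal_distr_r, ns_add_zero. f_equal. ring.
Qed.

Lemma scal_zero_r a : a [*] ns_zero X = ns_zero X.
Proof.
  apply (add_cancel_l (a [*] ns_zero X)).
  rewrite <- ns_scal_distr_l, !ns_add_zero. reflexivity.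
Qed.

Lemma opp_scal x : ns_opp X x = (-1) [*] x.
Proof.
  apply (add_cancel_l x). rewrite ns_add_opp.
  rewrite <- (ns_scal_one X x) at 1. rewrite <- ns_scal_distr_r.
  replace (1 + -1) with 0 by ring. symmetry. apply scal_zero_l.
Qed.

Lemma add_swap x y z t : (x [+] y) [+] (z [+] t) = (x [+] z) [+] (y [+] t).
Proof.
  rewrite <- !ns_add_assoc. f_equal. rewrite !ns_add_assoc. f_equal. apply ns_add_comm.
Qed.

Lemma vcomb_add (env : nat -> X) n c d :
  vcomb env n c [+] vcomb env n d = vcomb env n (fun i => c i + d i).
Proof.
  induction n as [|n IH]; simpl.
  - apply ns_add_zero.
  - rewrite add_swap, IH, ns_scal_distr_r. reflexivity.
Qed.

Lemma vcomb_scal (env : nat -> X) n a c :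
  a [*] vcomb env n c = vcomb env n (fun i => a * c i).
Proof.
  induction n as [|n IH]; simpl.
  - apply scal_zero_r.
  - rewrite ns_scal_distr_l, IH, ns_scal_assoc. reflexivity.
Qed.

Lemma vcomb_ext (env : nat -> X) n c d :
  (forall i, (i < n)%nat -> c i = d i) -> vcomb env n c = vcomb env n d.
Proof.
  intro H. induction n as [|n IH]; simpl; [reflexivity|].
  rewrite IH by (intros; apply H; lia). rewrite (H n) by lia. reflexivity.
Qed.

Lemma vcomb_zero (env : nat -> X) n c :
  (forall i, (i < n)%nat -> c i = 0) -> vcomb env n c = ns_zero X.
Proof.
  intro H. induction n as [|n IH]; simpl; [reflexivity|].
  rewrite IH by (intros; apply H; lia). rewrite (H n), scal_zero_l by lia.
  apply ns_add_zero.
Qed.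

Lemma vcomb_var (env : nat -> X) n i :
  (i < n)%nat -> vcomb env n (fun j => if Nat.eqb i j then 1 else 0) = env i.
Proof.
  induction n as [|n IH]; simpl; intro H; [lia|].
  destruct (Nat.eqb_spec i n) as [->|Hne].
  - rewrite vcomb_zero, add_zero_l, ns_scal_one; [reflexivity|].
    intros j Hj. destruct (Nat.eqb_spec n j); [lia|reflexivity].
  - rewrite IH, scal_zero_l by lia. apply ns_add_zero.
Qed.

Lemma veval_vcomb (env : nat -> X) n e :
  vbound n e = true -> veval env e = vcomb env n (vcoef e).
Proof.
  induction e as [i|e1 IH1 e2 IH2|r e IH|e IH|]; simpl; intro H.
  - symmetry. apply vcomb_var. now apply Nat.ltb_lt.
  - apply Bool.andb_true_iff in H. destruct H.
    rewrite IH1, IH2 by assumption. apply vcomb_add.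
  - rewrite IH by assumption. apply vcomb_scal.
  - rewrite IH, opp_scal, vcomb_scal by assumption. apply vcomb_ext. intros. ring.
  - symmetry. now apply vcomb_zero.
Qed.

Lemma veval_eq (env : nat -> X) n e1 e2 :
  vbound n e1 = true -> vbound n e2 = true -> vcoef_agree n e1 e2 ->
  veval env e1 = veval env e2.
Proof.
  intros H1 H2 H. rewrite (veval_vcomb env n e1), (veval_vcomb env n e2) by assumption.
  clear H1 H2. apply vcomb_ext. revert H. induction n as [|n IH]; simpl; intros H i Hi; [lia|].
  destruct (Nat.eq_dec i n) as [->|]; [apply H|]. apply IH; [apply H|lia].
Qed.

End LinearCombinations.

Ltac vatoms t l :=
  lazymatch t with
  | ns_add _ ?a ?b => let l := vatoms a l in vatoms b l
  | ns_sub _ ?a ?b => let l := vatoms a l in vatoms b l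
  | ns_scal _ _ ?a => vatoms a l
  | ns_opp _ ?a => vatoms a l
  | ns_zero _ => l
  | _ => lazymatch l with
         | context [cons t _] => l
         | _ => constr:(cons t l)
         end
  end.

Ltac vindex t l :=
  lazymatch l with
  | cons t _ => constr:(O)
  | cons _ ?l => let n := vindex t l in constr:(S n)
  end.

Ltac vreify t l :=
  lazymatch t with
  | ns_add _ ?a ?b => let a := vreify a l in let b := vreify b l in constr:(VAdd a b)
  | ns_sub _ ?a ?b => let a := vreify a l in let b := vreify b l in constr:(VAdd a (VOpp b))
  | ns_scal _ ?r ?a => let a := vreify a l in constr:(VScal r a)
  | ns_opp _ ?a => let a := vreify a l in constr:(VOpp a)
  | ns_zero _ => constr:(VZero)
  | _ => let n := vindex t l in constr:(VVar n)
  end.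

Ltac vfield :=
  lazymatch goal with
  | |- @eq (ns_car ?X) ?a ?b =>
    let l := vatoms a (@nil (ns_car X)) in
    let l := vatoms b l in
    let ea := vreify a l in
    let eb := vreify b l in
    change (veval (fun n => nth n l (ns_zero X)) ea = veval (fun n => nth n l (ns_zero X)) eb);
    apply (veval_eq _ (length l)); [reflexivity|reflexivity|];
    cbn [vcoef_agree vcoef length Nat.eqb]; repeat split; try field; try lra
  end.

(** * Norms, functionals and Baire's theorem *)

Section NormsAndFunctionals.

Context {X : NormedSpace}.
Implicit Types (x y z : X) (a b r : R).

Lemma norm_zero : norm (ns_zero X) = 0.
Proof. rewrite <- (scal_zero_l (ns_zero X)), ns_norm_scal, Rabs_R0. ring. Qed.

Lemma norm_opp x : norm (ns_opp X x) = norm x.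
Proof. rewrite opp_scal, ns_norm_scal, Rabs_left by lra. ring. Qed.

Lemma norm_nonneg x : 0 <= norm x.
Proof.
  pose proof (ns_norm_triangle X x (ns_opp X x)) as H.
  rewrite ns_add_opp, norm_zero, norm_opp in H. lra.
Qed.

Lemma norm_sub_sym x y : norm (x [-] y) = norm (y [-] x).
Proof. rewrite <- norm_opp. f_equal. vfield. Qed.

Lemma norm_sub_triangle x y z : norm (x [-] z) <= norm (x [-] y) + norm (y [-] z).
Proof.
  replace (x [-] z) with ((x [-] y) [+] (y [-] z)) by vfield. apply ns_norm_triangle.
Qed.

Lemma norm_sub_self x : norm (x [-] x) = 0.
Proof. replace (x [-] x) with (ns_zero X) by vfield. apply norm_zero. Qed.

Lemma norm_scal_pos a x : 0 <= a -> norm (a [*] x) = a * norm x.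
Proof. intro. rewrite ns_norm_scal, Rabs_pos_eq by assumption. reflexivity. Qed.

Lemma dual_zero (f : Dual X) : f (ns_zero X) = 0.
Proof. rewrite <- (scal_zero_l (ns_zero X)), dual_scal. ring. Qed.

Lemma dual_opp (f : Dual X) x : f (ns_opp X x) = - f x.
Proof. rewrite opp_scal, dual_scal. ring. Qed.

Lemma dual_sub (f : Dual X) x y : f (x [-] y) = f x - f y.
Proof. unfold ns_sub. rewrite dual_add, dual_opp. ring. Qed.

Lemma dual_bound_pos (f : Dual X) : exists M, 0 < M /\ forall x, Rabs (f x) <= M * norm x.
Proof.
  destruct (dual_bdd _ f) as [M HM]. exists (Rabs M + 1).
  split; [pose proof (Rabs_pos M); lra|]. intro x.
  apply Rle_trans with (1 := HM x). apply Rmult_le_compat_r; [apply norm_nonneg|].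
  pose proof (Rle_abs M). lra.
Qed.

Lemma dual_continuous (f : Dual X) x b : f x > b ->
  exists s, 0 < s /\ forall y, norm (y [-] x) < s -> f y > b.
Proof.
  intro H. destruct (dual_bound_pos f) as [M [HM Hf]].
  exists ((f x - b) / M). split; [apply Rdiv_lt_0_compat; lra|]. intros y Hy.
  pose proof (Hf (y [-] x)) as H1. rewrite dual_sub in H1.
  assert (M * norm (y [-] x) < f x - b).
  { apply Rmult_lt_reg_l with (/ M); [now apply Rinv_0_lt_compat|].
    replace (/ M * (M * norm (y [-] x))) with (norm (y [-] x)) by (field; lra).
    unfold Rdiv in Hy. lra. }
  pose proof (Rle_abs (- (f y - f x))) as H2. rewrite Rabs_Ropp in H2. lra.
Qed.

Lemma dual_bound_of_ball (f : Dual X) s K : 0 < s ->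
  (forall v, norm v <= s -> f v <= K) -> forall v, Rabs (f v) <= K / s * norm v.
Proof.
  intros Hs H.
  assert (H1 : forall v, f v <= K / s * norm v).
  { intro v. destruct (norm_nonneg v) as [Hv|Hv].
    - specialize (H ((s / norm v) [*] v)).
      rewrite dual_scal, norm_scal_pos in H by (apply Rlt_le, Rdiv_lt_0_compat; lra).
      replace (s / norm v * norm v) with s in H by (field; lra).
      specialize (H (Rle_refl _)).
      apply Rmult_le_reg_l with (s / norm v); [apply Rdiv_lt_0_compat; lra|].
      replace (s / norm v * (K / s * norm v)) with K by (field; lra). exact H.
    - rewrite <- Hv. symmetry in Hv. apply ns_norm_eq0 in Hv. rewrite Hv, dual_zero. lra. }
  intro v. apply Rabs_le. split; [|apply H1].
  pose proof (H1 (ns_opp X v)) as H2. rewrite dual_opp, norm_opp in H2. lra.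
Qed.

Definition dual_lin (a : R) (f : Dual X) (b : R) (h : Dual X) : Dual X.
Proof.
  refine (Build_Dual X (fun x => a * f x + b * h x) _ _ _).
  - intros. rewrite !dual_add. ring.
  - intros. rewrite !dual_scal. ring.
  - destruct (dual_bdd _ f) as [M HM]. destruct (dual_bdd _ h) as [N HN].
    exists (Rabs a * M + Rabs b * N). intro x.
    apply Rle_trans with (1 := Rabs_triang _ _). rewrite !Rabs_mult.
    pose proof (Rmult_le_compat_l _ _ _ (Rabs_pos a) (HM x)).
    pose proof (Rmult_le_compat_l _ _ _ (Rabs_pos b) (HN x)). lra.
Defined.

Definition ball (c : X) (r : R) : X -> Prop := fun x => norm (x [-] c) < r.

Lemma ball_center c r : 0 < r -> ball c r c.
Proof. intro. unfold ball. now rewrite norm_sub_self. Qed.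

Lemma ball_subset c r d s : norm (d [-] c) + s <= r -> forall x, ball d s x -> ball c r x.
Proof.
  unfold ball. intros H x Hx. pose proof (norm_sub_triangle x d c). lra.
Qed.

(** Density is asked in the form of a game: each ball inside the given one contains a smaller ball
    lying in [G n]. Thus [G n] may be any set with dense interior there. *)
Lemma baire (HX : Banach X) (G : nat -> X -> Prop) (c : X) (r : R) : 0 < r ->
  (forall n y s, 0 < s -> (forall x, ball y s x -> ball c r x) ->
     exists z t, 0 < t /\ forall x, ball z t x -> ball y s x /\ G n x) ->
  exists x, ball c r x /\ forall n, G n x.
Proof.
  intros Hr H.
  pose (good := fun p : X * R => 0 < snd p /\ forall x, ball (fst p) (snd p) x -> ball c r x).
  assert (Hstep : forall np : nat * (X * R), exists q : X * R, good (snd np) ->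
    good q /\ snd q <= snd (snd np) / 2 /\
    forall x, norm (x [-] fst q) <= snd q -> ball (fst (snd np)) (snd (snd np)) x /\ G (fst np) x).
  { intros [n p]. destruct (classic (good p)) as [Hp|Hp]; [|exists p; intro; contradiction].
    destruct (H n (fst p) (snd p)) as [z [t [Ht Hz]]]; [apply Hp|apply Hp|].
    pose proof (proj1 Hp). pose proof (Rmin_l t (snd p)). pose proof (Rmin_r t (snd p)).
    assert (0 < Rmin t (snd p)) by (apply Rmin_glb_lt; lra).
    (* Halving puts the closed ball inside the open ball around [z], so that the limit of the
       centres stays inside, and makes the radii tend to zero. *)
    exists (z, Rmin t (snd p) / 2). intros _.
    split; [split; simpl; [lra|]|split; simpl; [lra|]].
    - intros x Hx. apply (proj2 Hp). apply Hz. unfold ball in *. lra.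
    - intros x Hx. apply Hz. unfold ball in *. lra. }
  pose (next := fun np => proj1_sig (constructive_indefinite_description _ (Hstep np))).
  assert (Hnext : forall np, good (snd np) -> good (next np) /\ snd (next np) <= snd (snd np) / 2 /\
    forall x, norm (x [-] fst (next np)) <= snd (next np) ->
      ball (fst (snd np)) (snd (snd np)) x /\ G (fst np) x).
  { intro np. exact (proj2_sig (constructive_indefinite_description _ (Hstep np))). }
  clearbody next. clear Hstep.
  pose (u := nat_rect (fun _ => (X * R)%type) (c, r) (fun n p => next (n, p))).
  assert (Hu : forall n, good (u n)).
  { induction n as [|n IH]; [split; simpl; auto|]. apply (Hnext (n, u n) IH). }
  assert (Hrad : forall n, snd (u n) <= r * (/ 2) ^ n).
  { induction n as [|n IH]; [simpl; lra|].
    pose proof (proj1 (proj2 (Hnext (n, u n) (Hu n)))) as H1.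
    change (snd (u (S n)) <= snd (u n) / 2) in H1. rewrite <- tech_pow_Rmult.
    replace (r * (/ 2 * (/ 2) ^ n)) with (r * (/ 2) ^ n / 2) by field. lra. }
  assert (Hin : forall n k x, ball (fst (u (n + k)%nat)) (snd (u (n + k)%nat)) x ->
    ball (fst (u n)) (snd (u n)) x).
  { intros n k. induction k as [|k IH]; intros x Hx.
    - now rewrite Nat.add_0_r in Hx.
    - apply IH. rewrite Nat.add_succ_r in Hx.
      apply (Hnext ((n + k)%nat, u (n + k)%nat) (Hu _)). apply Rlt_le. exact Hx. }
  assert (Hcen : forall n m, (n <= m)%nat -> ball (fst (u n)) (snd (u n)) (fst (u m))).
  { intros n m Hnm. replace m with (n + (m - n))%nat by lia. apply (Hin n (m - n)%nat).
    apply ball_center, Hu. }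
  assert (Hsmall : forall e, e > 0 -> exists N, snd (u N) < e).
  { intros e He. destruct (pow_lt_1_zero (/ 2)) with (y := e / r) as [N HN].
    - rewrite Rabs_pos_eq; lra.
    - apply Rdiv_lt_0_compat; lra.
    - exists N. specialize (HN N (le_n N)).
      rewrite Rabs_pos_eq in HN by (apply pow_le; lra).
      apply Rle_lt_trans with (1 := Hrad N).
      apply Rmult_lt_compat_l with (r := r) in HN; [|lra].
      replace (r * (e / r)) with e in HN by (field; lra). exact HN. }
  destruct (HX (fun n => fst (u n))) as [l Hl].
  { intros e He. destruct (Hsmall (e / 2)) as [N HN]; [lra|]. exists N. intros m n Hm Hn.
    pose proof (norm_sub_triangle (fst (u m)) (fst (u N)) (fst (u n))) as H1.
    rewrite (norm_sub_sym (fst (u N))) in H1.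
    pose proof (Hcen N m Hm). pose proof (Hcen N n Hn). unfold ball in *. lra. }
  assert (Hlim : forall n, norm (l [-] fst (u n)) <= snd (u n)).
  { intro n. apply le_epsilon. intros e He. destruct (Hl e He) as [N HN].
    specialize (HN (max N n) (Nat.le_max_l _ _)).
    pose proof (Hcen n (max N n) (Nat.le_max_r _ _)) as H1. unfold ball in H1.
    pose proof (norm_sub_triangle l (fst (u (max N n))) (fst (u n))) as H2.
    rewrite (norm_sub_sym l (fst (u (max N n)))) in H2. lra. }
  exists l. split.
  - apply (Hnext (O, u O) (Hu O)). exact (Hlim 1%nat).
  - intro n. apply (Hnext (n, u n) (Hu n)). exact (Hlim (S n)).
Qed.

End NormsAndFunctionals.

(** * Weak-star topology *)

Lemma ultrafilter_above (T : Type) (F : (T -> Prop) -> Prop) :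
  F (fun _ => True) ->
  (forall P Q, F P -> F Q -> F (fun x => P x /\ Q x)) ->
  (forall P Q : T -> Prop, (forall x, P x -> Q x) -> F P -> F Q) ->
  ~ F (fun _ => False) ->
  exists G : (T -> Prop) -> Prop,
    (forall P, F P -> G P) /\
    (forall P Q, G P -> G Q -> G (fun x => P x /\ Q x)) /\
    (forall P Q : T -> Prop, (forall x, P x -> Q x) -> G P -> G Q) /\
    ~ G (fun _ => False) /\
    (forall P, G P \/ G (fun x => ~ P x)).
Proof.
  intros HT HI HS H0.
  assert (HF : filter.ProperFilter F).
  { split; [exact H0|]. split; [exact HT|exact HI|exact HS]. }
  destruct (filter.ultraFilterLemma HF) as [G [HG HFG]].
  exists G. pose proof (@filter.ultra_proper _ _ HG) as [HG0 [HGT HGI HGS]].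
  split; [exact HFG|]. split; [exact HGI|]. split; [exact HGS|]. split; [exact HG0|].
  intro P. exact (filter.in_ultra_setVsetC P HG).
Qed.

Section WeakStar.

Context {X : NormedSpace}.

(** If no finite subfamily covers [K], the parts of [K] missed by finite subfamilies generate a
    proper filter. An ultrafilter above it converges pointwise by the bound [L]; the limit is a
    functional in [K], and a member of the cover containing it belongs to the ultrafilter together
    with its complement. *)
Lemma banach_alaoglu (K : Dual X -> Prop) (L : R) :
  wstar_closed K -> (forall y, K y -> forall x, Rabs (y x) <= L * norm x) -> wstar_compact K.
Proof.
  intros HK HL I U HU Hcov. apply NNPP. intro Hno.
  pose (F := fun S : Dual X -> Prop => exists l : list I,
    forall y, K y -> ~ (exists i, In i l /\ U i y) -> S y).
  destruct (ultrafilter_above _ F) as [G [HFG [HGI [HGS [HG0 HGU]]]]].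
  - exists nil. auto.
  - intros P Q [l1 H1] [l2 H2]. exists (l1 ++ l2). intros y Hy Hn. split.
    + apply H1; [assumption|]. intros [i [Hi HUi]]. apply Hn. exists i.
      split; [apply in_or_app; now left|assumption].
    + apply H2; [assumption|]. intros [i [Hi HUi]]. apply Hn. exists i.
      split; [apply in_or_app; now right|assumption].
  - intros P Q HPQ [l Hl]. exists l. intros y Hy Hn. apply HPQ. now apply Hl.
  - intros [l Hl]. apply Hno. exists l. intros y Hy. apply NNPP. intro Hn. exact (Hl y Hy Hn).
  - assert (HGK : G K). { apply HFG. exists nil. auto. }
    assert (HGne : forall P : Dual X -> Prop, G P -> exists y, P y).
    { intros P HP. apply NNPP. intro Hn. apply HG0. apply (HGS P); [|assumption].
      intros y Hy. apply Hn. now exists y. }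
    assert (Hlim : forall x, exists a, forall e, 0 < e -> G (fun y => Rabs (y x - a) < e)).
    { intro x.
      (* The limit is the supremum of the levels [a] with [a <= y x] for [G]-almost all [y]; above
         it, the ultrafilter must contain the opposite half-space. *)
      destruct (completeness (fun a => G (fun y => a <= y x))) as [a [Ha1 Ha2]].
      - exists (L * norm x). intros a Ha.
        destruct (HGne _ (HGI _ _ HGK Ha)) as [y [Hy1 Hy2]].
        pose proof (HL y Hy1 x). pose proof (Rle_abs (y x)). lra.
      - exists (- (L * norm x)). apply (HGS K); [|assumption]. intros y Hy.
        pose proof (HL y Hy x). pose proof (Rle_abs (- y x)). rewrite Rabs_Ropp in *. lra.
      - exists a. intros e He.
        assert (H1 : G (fun y => a - e < y x)).
        { apply NNPP. intro Hn. assert (a <= a - e); [|lra]. apply Ha2. intros b Hb.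
          apply Rnot_lt_le. intro Hlt. apply Hn. apply (HGS (fun y => b <= y x)); [|assumption].
          intros. lra. }
        assert (H2 : G (fun y => ~ (a + e / 2 <= y x))).
        { destruct (HGU (fun y : Dual X => a + e / 2 <= y x)) as [H|H]; [|assumption].
          apply Ha1 in H. lra. }
        apply (HGS (fun y : Dual X => a - e < y x /\ ~ (a + e / 2 <= y x))).
        + intros y [H3 H4]. apply Rabs_def1; lra.
        + now apply HGI. }
    pose (phi := fun x => proj1_sig (constructive_indefinite_description _ (Hlim x))).
    assert (Hphi : forall x e, 0 < e -> G (fun y => Rabs (y x - phi x) < e)).
    { intro x. exact (proj2_sig (constructive_indefinite_description _ (Hlim x))). }
    clearbody phi. clear Hlim.
    assert (Hadd : forall x z, phi (x [+] z) = phi x + phi z).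
    { intros x z. apply cond_eq. intros e He.
      destruct (HGne _ (HGI _ _ (Hphi (x [+] z) (e / 3) ltac:(lra))
        (HGI _ _ (Hphi x (e / 3) ltac:(lra)) (Hphi z (e / 3) ltac:(lra))))) as [y [H1 [H2 H3]]].
      rewrite dual_add in H1. apply Rabs_def2 in H1, H2, H3. apply Rabs_def1; lra. }
    assert (Hscal : forall a x, phi (a [*] x) = a * phi x).
    { intros a x. apply cond_eq. intros e He.
      pose proof (Rabs_pos a) as Ha.
      assert (Hd : 0 < e / (2 * (Rabs a + 1))) by (apply Rdiv_lt_0_compat; lra).
      destruct (HGne _ (HGI _ _ (Hphi (a [*] x) (e / 2) ltac:(lra)) (Hphi x _ Hd)))
        as [y [H1 H2]].
      rewrite dual_scal in H1.
      assert (H3 : Rabs (a * (y x - phi x)) <= e / 2).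
      { rewrite Rabs_mult. apply Rle_trans with (Rabs a * (e / (2 * (Rabs a + 1)))).
        - apply Rmult_le_compat_l; lra.
        - apply Rle_trans with ((Rabs a + 1) * (e / (2 * (Rabs a + 1)))).
          + apply Rmult_le_compat_r; lra.
          + right. field. lra. }
      replace (phi (a [*] x) - a * phi x)
        with (- (a * y x - phi (a [*] x)) + a * (y x - phi x)) by ring.
      apply Rle_lt_trans with (1 := Rabs_triang _ _). rewrite Rabs_Ropp. lra. }
    assert (Hbd : forall x, Rabs (phi x) <= L * norm x).
    { intro x. apply le_epsilon. intros e He.
      destruct (HGne _ (HGI _ _ HGK (Hphi x e He))) as [y [H1 H2]].
      pose proof (HL y H1 x). replace (phi x) with (y x + - (y x - phi x)) by ring.
      apply Rle_trans with (1 := Rabs_triang _ _). rewrite Rabs_Ropp. lra. }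
    pose (f := Build_Dual X phi Hadd Hscal (ex_intro _ L Hbd)).
    assert (Hnbd : forall V, wstar_open V -> V f -> G V).
    { intros V HV HVf. destruct (HV f HVf) as [l [e [He Hl]]].
      apply (HGS (fun y => forall x, In x l -> Rabs (y x - f x) < e)); [exact Hl|].
      clear Hl. induction l as [|x l IH].
      - apply (HGS K); [|assumption]. intros y _ x [].
      - apply (HGS (fun y => Rabs (y x - phi x) < e /\ forall z, In z l -> Rabs (y z - f z) < e)).
        + intros y [H1 H2] z [<-|Hz]; [exact H1|now apply H2].
        + apply HGI; [now apply Hphi|exact IH]. }
    assert (HKf : K f).
    { apply NNPP. intro Hn. pose proof (Hnbd _ HK Hn) as H1.
      destruct (HGne _ (HGI _ _ HGK H1)) as [y [H2 H3]]. contradiction. }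
    destruct (Hcov f HKf) as [i Hi]. pose proof (Hnbd _ (HU i) Hi) as H1.
    assert (H2 : G (fun y => ~ U i y)).
    { apply HFG. exists (i :: nil). intros y Hy Hn HUy. apply Hn. exists i. simpl. auto. }
    destruct (HGne _ (HGI _ _ H1 H2)) as [y [H3 H4]]. contradiction.
Qed.

Lemma wstar_open_gt (x : X) (c : R) : wstar_open (fun y : Dual X => y x > c).
Proof.
  intros y Hy. exists (x :: nil), (y x - c). split; [lra|]. intros v Hv.
  specialize (Hv x (or_introl eq_refl)). apply Rabs_def2 in Hv. lra.
Qed.

Lemma wstar_closed_le (x : X) (c : R) : wstar_closed (fun y : Dual X => y x <= c).
Proof.
  intros y Hy. apply Rnot_le_gt in Hy.
  destruct (wstar_open_gt x c y Hy) as [l [e [He Hl]]]. exists l, e. split; [exact He|].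
  intros v Hv. apply Rgt_not_le. now apply Hl.
Qed.

Lemma convex_le (x : X) (c : R) : convex_set (fun y : Dual X => y x <= c).
Proof.
  intros a b d t Ht Ha Hb Hd. rewrite Hd.
  replace c with (t * c + (1 - t) * c) by ring.
  apply Rplus_le_compat; apply Rmult_le_compat_l; lra.
Qed.

Lemma hull_subset (A : Dual X -> Prop) y : A y -> wstar_cl_conv_hull A y.
Proof. intros Hy C _ _ HC. now apply HC. Qed.

Lemma hull_closed (A : Dual X -> Prop) : wstar_closed (wstar_cl_conv_hull A).
Proof.
  intros y Hy.
  assert (H : exists C, wstar_closed C /\ convex_set C /\ (forall z, A z -> C z) /\ ~ C y).
  { apply NNPP. intro Hn. apply Hy. intros C H1 H2 H3. apply NNPP. intro H4.
    apply Hn. now exists C. }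
  destruct H as [C [H1 [H2 [H3 H4]]]]. destruct (H1 y H4) as [l [e [He Hl]]].
  exists l, e. split; [exact He|]. intros v Hv Hh. apply (Hl v Hv). now apply Hh.
Qed.

Lemma hull_convex (A : Dual X -> Prop) : convex_set (wstar_cl_conv_hull A).
Proof.
  intros a b c t Ht Ha Hb Hc C H1 H2 H3. apply (H2 a b c t Ht); [now apply Ha|now apply Hb|exact Hc].
Qed.

Lemma hull_le (A : Dual X -> Prop) (x : X) (c : R) :
  (forall y, A y -> y x <= c) -> forall y, wstar_cl_conv_hull A y -> y x <= c.
Proof.
  intros HA y Hy. apply (Hy (fun y => y x <= c)); [apply wstar_closed_le|apply convex_le|exact HA].
Qed.

Lemma hull_bounded (A : Dual X -> Prop) (L : R) :
  (forall y, A y -> forall x, Rabs (y x) <= L * norm x) ->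
  forall y, wstar_cl_conv_hull A y -> forall x, Rabs (y x) <= L * norm x.
Proof.
  intros HA y Hy x.
  assert (H : forall z, y z <= L * norm z).
  { intro z. apply (hull_le A); [|exact Hy]. intros w Hw.
    pose proof (HA w Hw z). pose proof (Rle_abs (w z)). lra. }
  apply Rabs_le. split; [|apply H].
  pose proof (H (ns_opp X x)) as H1. rewrite dual_opp, norm_opp in H1. lra.
Qed.

Lemma inv_INR_lt (e : R) : 0 < e -> exists N, forall n, (N <= n)%nat -> / INR (S n) < e.
Proof.
  intro He. destruct (archimed_cor1 e He) as [N [H1 H2]]. exists N. intros n Hn.
  apply Rle_lt_trans with (2 := H1). apply Rinv_le_contravar; [now apply lt_0_INR|].
  apply le_INR. lia.
Qed.

(* The Radon-Nikodym property yields w*-dentability: the w*-closed convex hull of A has a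
   strongly exposed point, and thin slices of the hull around it are small and meet A. *)
Lemma rnp_small_slice (HRNP : RNP_dual X) (A : Dual X -> Prop) (L e : R) :
  (exists y, A y) -> (forall y, A y -> forall x, Rabs (y x) <= L * norm x) -> 0 < e ->
  exists (u : X) (b : R) (y0 : Dual X), A y0 /\ y0 u > b /\
    forall y z, A y -> A z -> y u > b -> z u > b -> forall x, Rabs (y x - z x) <= e * norm x.
Proof.
  intros [a Ha] HL He. set (K := wstar_cl_conv_hull A).
  assert (HaK : K a) by now apply hull_subset.
  assert (HKL := hull_bounded A L HL). fold K in HKL.
  assert (HR := HRNP K (ex_intro _ a HaK)
    (banach_alaoglu K L (hull_closed A) HKL) (hull_convex A)).
  assert (Hex : exists us, wstar_strongly_exposed_pt K us).
  (* Without exposed points the empty set would be a w*-closed convex set containing all of them,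
     hence would contain [K]. *)
  { apply NNPP. intro Hn. apply (proj1 (HR a) HaK (fun _ => False)).
    - intros v _. exists nil, 1. split; [lra|]. auto.
    - intros ? ? ? ? ? [].
    - intros z Hz. apply Hn. exists z. exact Hz. }
  destruct Hex as [us [HKus [u Hu]]].
  destruct (completeness (fun v => exists y, K y /\ v = y u)) as [s [Hs1 Hs2]].
  { exists (L * norm u). intros v [y [Hy ->]].
    pose proof (HKL y Hy u). pose proof (Rle_abs (y u)). lra. }
  { exists (a u). now exists a. }
  specialize (Hu (ERfin s)).
  assert (Happ : forall d, d > 0 -> exists v, (exists y, K y /\ v = y u) /\ v > s - d).
  { intros d Hd. apply NNPP. intro Hn. assert (s <= s - d); [|lra].
    apply Hs2. intros v Hv. apply Rnot_lt_le. intro Hlt. apply Hn. exists v. now split. }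
  specialize (Hu (conj Hs1 Happ)).
  (* Otherwise points far from [us], taken from slices of depth [/ INR (S n)], would form a
     maximizing sequence for [u] that does not converge to [us]. *)
  assert (Hslice : exists d, d > 0 /\
    forall y, K y -> y u > s - d -> forall x, Rabs (y x - us x) <= e / 2 * norm x).
  { apply NNPP. intro Hn.
    assert (Hbad : forall n : nat, exists y, K y /\ y u > s - / INR (S n) /\
      ~ (forall x, Rabs (y x - us x) <= e / 2 * norm x)).
    { intro n. apply NNPP. intro Hn2. apply Hn. exists (/ INR (S n)).
      split; [apply Rinv_0_lt_compat, lt_0_INR; lia|]. intros y Hy1 Hy2. apply NNPP. intro Hy3.
      apply Hn2. exists y. auto. }
    pose (sq := fun n => proj1_sig (constructive_indefinite_description _ (Hbad n))).
    assert (Hsq : forall n, K (sq n) /\ sq n u > s - / INR (S n) /\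
      ~ (forall x, Rabs (sq n x - us x) <= e / 2 * norm x)).
    { intro n. exact (proj2_sig (constructive_indefinite_description _ (Hbad n))). }
    clearbody sq.
    destruct (Hu sq) with (eps := e / 2) as [N HN].
    - intro n. apply Hsq.
    - intros d Hd. destruct (inv_INR_lt d Hd) as [N HN]. exists N. intros n Hn'.
      specialize (HN n Hn'). unfold Rdist. destruct (Hsq n) as [H1 [H2 _]].
      assert (sq n u <= s) by (apply Hs1; now exists (sq n)).
      apply Rabs_def1; lra.
    - lra.
    - apply (proj2 (proj2 (Hsq N))). apply HN. apply le_n. }
  destruct Hslice as [d [Hd Hslice]].
  (* Otherwise the half-space [y u <= s - d] would contain [A], hence its hull [K], against the
     choice of [s]. *)
  assert (HA0 : exists y0, A y0 /\ y0 u > s - d).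
  { apply NNPP. intro Hn. assert (s <= s - d); [|lra]. apply Hs2. intros v [y [Hy ->]].
    revert y Hy. apply hull_le. intros y Hy. apply Rnot_lt_le. intro. apply Hn. now exists y. }
  destruct HA0 as [y0 [Hy0 Hy0u]]. exists u, (s - d), y0.
  split; [exact Hy0|]. split; [exact Hy0u|]. intros y z Hy Hz Hyu Hzu x.
  pose proof (Hslice y (hull_subset _ _ Hy) Hyu x) as H1.
  pose proof (Hslice z (hull_subset _ _ Hz) Hzu x) as H2.
  replace (y x - z x) with ((y x - us x) + - (z x - us x)) by ring.
  apply Rle_trans with (1 := Rabs_triang _ _). rewrite Rabs_Ropp. lra.
Qed.

End WeakStar.

(** * Subgradients of the conjugate function *)

Section Conjugate.

Context {X : NormedSpace} (g : Dual X -> ERbar).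

(* f(x) <= m, for f the restriction of g* to X. *)
Definition conj_ub (x : X) (m : R) : Prop :=
  forall (y : Dual X) (r : R), g y = ERfin r -> y x - r <= m.

Definition conj_bounded_ball (c : X) (s M : R) : Prop :=
  0 < s /\ forall x, ball c s x -> conj_ub x M.

Lemma subdiff_conj_ub y x r : g y = ERfin r -> subdiff_X g y x -> conj_ub x (y x - r).
Proof.
  intros Hr [r' [Hr' H]] z s Hs. rewrite Hr in Hr'. injection Hr' as <-.
  specialize (H z s Hs). lra.
Qed.

Lemma conj_ub_subdiff y x r : g y = ERfin r -> conj_ub x (y x - r) -> subdiff_X g y x.
Proof.
  intros Hr H. exists r. split; [exact Hr|]. intros z s Hs. specialize (H z s Hs). lra.
Qed.

Lemma conj_bounded_ball_sub c s M d t : conj_bounded_ball c s M -> 0 < t ->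
  (forall x, ball d t x -> ball c s x) -> conj_bounded_ball d t M.
Proof. intros [_ H] Ht Hd. split; [exact Ht|]. intros x Hx. apply H. now apply Hd. Qed.

Lemma conj_bounded_ball_half c s M d : conj_bounded_ball c s M -> ball c (s / 2) d ->
  conj_bounded_ball d (s / 2) M.
Proof.
  intros H Hd. apply (conj_bounded_ball_sub c s M); [exact H|destruct H; lra|].
  apply ball_subset. unfold ball in Hd. lra.
Qed.

(** The homothety with centre [a] and ratio [t] carries the ball around [c] onto the new ball; the
    bound is convexity of the conjugate. At [a] itself only finiteness enters, so [a] may be a
    boundary point of the domain. *)
Lemma conj_bounded_ball_segment a m c s M t : conj_ub a m -> conj_bounded_ball c s M ->
  0 < t <= 1 -> conj_bounded_ball (a [+] t [*] (c [-] a)) (t * s) ((1 - t) * m + t * M).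
Proof.
  intros Ha [Hs Hc] Ht. split; [apply Rmult_lt_0_compat; lra|]. intros x Hx y r Hr.
  unfold ball in Hx. set (p := a [+] t [*] (c [-] a)) in *.
  set (z := c [+] (/ t) [*] (x [-] p)).
  assert (Hz : ball c s z).
  { unfold ball, z. replace (c [+] / t [*] (x [-] p) [-] c) with (/ t [*] (x [-] p)) by vfield.
    rewrite norm_scal_pos by (apply Rlt_le, Rinv_0_lt_compat; lra).
    apply Rmult_lt_reg_l with t; [lra|].
    rewrite <- Rmult_assoc, Rinv_r, Rmult_1_l by lra. exact Hx. }
  assert (Hxz : x = (1 - t) [*] a [+] t [*] z) by (unfold z, p; vfield).
  rewrite Hxz, dual_add, !dual_scal.
  specialize (Ha y r Hr). specialize (Hc z Hz y r Hr).
  apply Rmult_le_compat_l with (r := t) in Hc; [|lra].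
  apply Rmult_le_compat_l with (r := 1 - t) in Ha; [|lra]. lra.
Qed.

(** Testing the bound at [x + v] gives [y v <= M + B] whenever [norm v <= s / 2]. Near-maximizers
    are covered as well as subgradients, which places them all in one w*-compact ball. *)
Lemma near_maximizer_bound x s M y r B : conj_bounded_ball x s M -> g y = ERfin r ->
  - B <= y x - r -> forall v, Rabs (y v) <= (M + B) / (s / 2) * norm v.
Proof.
  intros [Hs H] Hr HB. apply dual_bound_of_ball; [lra|]. intros v Hv.
  assert (Hxv : ball x s (x [+] v)).
  { unfold ball. replace (x [+] v [-] x) with v by vfield. lra. }
  specialize (H _ Hxv y r Hr). rewrite dual_add in H. lra.
Qed.

Context (Hproper : proper_fun g).

Lemma proper_point : exists y r, g y = ERfin r.
Proof.
  destruct Hproper as [y Hy]. exists y. destruct (g y) as [r|]; [now exists r|contradiction].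
Qed.

Lemma subdiff_locally_bounded p s M : conj_bounded_ball p s M ->
  exists L, 0 < L /\ forall x y, ball p (s / 2) x -> subdiff_X g y x ->
    forall v, Rabs (y v) <= L * norm v.
Proof.
  intro H. destruct proper_point as [y0 [r0 Hr0]].
  destruct (dual_bound_pos y0) as [C [HC Hy0]].
  (* A subgradient at [x] maximizes [y x - g y], so its value is at least that of the fixed point
     [y0], which is at least [- B] near [p]. *)
  set (B := C * (norm p + s) + r0).
  assert (Hs : 0 < s) by apply H.
  exists (Rmax 1 ((M + B) / (s / 2 / 2))).
  split; [pose proof (Rmax_l 1 ((M + B) / (s / 2 / 2))); lra|].
  intros x y Hx Hy v. destruct (Hy) as [r [Hr _]].
  pose proof (subdiff_conj_ub y x r Hr Hy y0 r0 Hr0) as H1.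
  assert (H2 : norm x <= norm p + s).
  { replace x with ((x [-] p) [+] p) by vfield.
    apply Rle_trans with (1 := ns_norm_triangle _ _ _). unfold ball in Hx. lra. }
  apply Rmult_le_compat_l with (r := C) in H2; [|lra].
  pose proof (Hy0 x) as H3. pose proof (Rle_abs (- y0 x)) as H4. rewrite Rabs_Ropp in H4.
  assert (H5 := near_maximizer_bound x (s / 2) M y r B
    (conj_bounded_ball_half p s M x H Hx) Hr ltac:(unfold B; lra) v).
  apply Rle_trans with (1 := H5). apply Rmult_le_compat_r; [apply norm_nonneg|apply Rmax_r].
Qed.

(** * Existence of subgradients by weak-star compactness *)

Context (Hlsc : wstar_lsc g).

(** This is upper semicontinuity of [y x - g y]; points with [g y = ERinf] belong to the set
    vacuously. *)
Lemma wstar_open_conj_gap (x : X) (c : R) :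
  wstar_open (fun y : Dual X => forall r, g y = ERfin r -> y x - r < c).
Proof.
  intros y Hy.
  assert (Hq : exists q, q > y x - c /\ ~ ER_le (g y) (ERfin q)).
  { destruct (g y) as [r|].
    - specialize (Hy r eq_refl). exists ((y x - c + r) / 2). simpl. split; lra.
    - exists (y x - c + 1). simpl. split; [lra|tauto]. }
  destruct Hq as [q [Hq1 Hq2]]. destruct (Hlsc q y Hq2) as [l [e [He Hl]]].
  exists (x :: l), (Rmin e (q - (y x - c))).
  split; [apply Rmin_glb_lt; lra|]. intros v Hv r Hr.
  assert (H1 := Hv x (or_introl eq_refl)). pose proof (Rmin_r e (q - (y x - c))).
  apply Rabs_def2 in H1.
  assert (H2 : ~ ER_le (g v) (ERfin q)).
  { apply Hl. intros z Hz. apply Rlt_le_trans with (1 := Hv z (or_intror Hz)). apply Rmin_l. }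
  rewrite Hr in H2. simpl in H2. lra.
Qed.

Lemma wstar_closed_ball (L : R) :
  wstar_closed (fun y : Dual X => forall x, Rabs (y x) <= L * norm x).
Proof.
  intros y Hy. apply not_all_ex_not in Hy. destruct Hy as [x Hx]. apply Rnot_le_gt in Hx.
  exists (x :: nil), (Rabs (y x) - L * norm x). split; [lra|]. intros v Hv Hb.
  specialize (Hv x (or_introl eq_refl)). specialize (Hb x).
  pose proof (Rabs_triang (v x) (- (v x - y x))) as H.
  replace (v x + - (v x - y x)) with (y x) in H by ring. rewrite Rabs_Ropp in H. lra.
Qed.

(** A subgradient is a point where the supremum [m] of [y x - g y] is attained. If there is none,
    the sets of points falling short of [m] by more than some [e] cover a w*-compact ball holding
    the near-maximizers, and a finite subcover yields a uniform shortfall. *)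
Lemma subdiff_exists x s M : conj_bounded_ball x s M -> exists y, subdiff_X g y x.
Proof.
  intro H. destruct proper_point as [y0 [r0 Hr0]].
  assert (HxM : conj_ub x M) by (apply H, ball_center, H).
  destruct (completeness (fun v => exists y r, g y = ERfin r /\ v = y x - r)) as [m [Hm1 Hm2]].
  { exists M. intros v [y [r [Hr ->]]]. now apply HxM. }
  { exists (y0 x - r0), y0, r0. auto. }
  assert (Hmub : conj_ub x m). { intros y r Hr. apply Hm1. exists y, r. auto. }
  apply NNPP. intro Hno.
  (* Within 1 of the supremum one has [y x - r >= - (Rabs m + 1)], and [near_maximizer_bound] gives
     this radius. *)
  pose (L := (M + (Rabs m + 1)) / (s / 2)).
  assert (HK := banach_alaoglu _ L (wstar_closed_ball L) (fun y Hy => Hy)).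
  destruct (HK R (fun e y => 0 < e /\ forall r, g y = ERfin r -> y x - r < m - e)) as [l Hl].
  - intros e y [He Hy]. destruct (wstar_open_conj_gap x (m - e) y Hy) as [l [d [Hd Hl]]].
    exists l, d. split; [exact Hd|]. intros v Hv. split; [exact He|]. now apply Hl.
  - intros y _. case_eq (g y).
    + intros r Hr. pose proof (Hmub y r Hr) as H1.
      assert (y x - r <> m).
      { intro Heq. apply Hno. exists y. apply (conj_ub_subdiff y x r Hr). now rewrite Heq. }
      exists ((m - (y x - r)) / 2). split; [lra|]. intros r' Hr'. injection Hr' as <-. lra.
    + intro Hr. exists 1. split; [lra|]. discriminate.
  (* The indices are all reals; those with [i <= 0] label empty sets, so only the positive ones
     count for the uniform gap. *)
  - assert (He0 : exists e0, 0 < e0 /\ forall i, In i l -> 0 < i -> e0 <= i).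
    { clear Hl. induction l as [|i l [e0 [He0 IH]]].
      - exists 1. split; [lra|]. intros i [].
      - destruct (Rlt_dec 0 i) as [Hi|Hi].
        + exists (Rmin e0 i). split; [now apply Rmin_glb_lt|]. intros j [<-|Hj] Hj0.
          * apply Rmin_r.
          * apply Rle_trans with (1 := Rmin_l _ _). now apply IH.
        + exists e0. split; [exact He0|]. intros j [<-|Hj] Hj0; [contradiction|now apply IH]. }
    destruct He0 as [e0 [He0 Hle]].
    assert (Hnear : exists y r, g y = ERfin r /\ y x - r > m - Rmin e0 1).
    { apply NNPP. intro Hn. assert (0 < Rmin e0 1) by (apply Rmin_glb_lt; lra).
      assert (m <= m - Rmin e0 1); [|lra]. apply Hm2. intros v [y [r [Hr ->]]].
      apply Rnot_lt_le. intro. apply Hn. exists y, r. auto. }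
    destruct Hnear as [y [r [Hr Hyr]]].
    pose proof (Rmin_l e0 1). pose proof (Rmin_r e0 1).
    pose proof (Rle_abs (- m)) as Habs. rewrite Rabs_Ropp in Habs.
    destruct (Hl y) as [i [Hi [Hi0 HU]]].
    + apply (near_maximizer_bound x s M y r); [exact H|exact Hr|lra].
    + specialize (HU r Hr). specialize (Hle i Hi Hi0). lra.
Qed.

(** * Small oscillation of the subdifferential and exposed points *)

Context (HRNP : RNP_dual X).

(** This replaces difference quotients: near a point around which the conjugate is bounded above,
    having it for each [e] on some ball around the point amounts to Fréchet differentiability
    there. *)
Definition subdiff_small (e : R) (c : X) (s : R) : Prop :=
  forall x x' y y', ball c s x -> ball c s x' -> subdiff_X g y x -> subdiff_X g y' x' ->
    forall v, Rabs (y v - y' v) <= e * norm v.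

Lemma subdiff_monotone x x' y y' : subdiff_X g y x -> subdiff_X g y' x' ->
  0 <= (y x - y' x) - (y x' - y' x').
Proof.
  intros [r [Hr H]] [r' [Hr' H']]. specialize (H y' r' Hr'). specialize (H' y r Hr). lra.
Qed.

(* By monotonicity, moving from a base point of a subgradient y0 in the direction u that
   defines a slice containing y0 keeps all subgradients inside this slice. *)
Lemma subdiff_small_dense p s M e q t : conj_bounded_ball p s M -> 0 < e -> 0 < t ->
  (forall x, ball q t x -> ball p (s / 2) x) ->
  exists z d, 0 < d /\ (forall x, ball z d x -> ball q t x) /\ subdiff_small e z d.
Proof.
  intros H He Ht Hq.
  destruct (subdiff_locally_bounded p s M H) as [L [HL0 HL]].
  destruct (rnp_small_slice HRNP (fun y => exists x, ball q t x /\ subdiff_X g y x) L e)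
    as [u [b [y0 [[x0 [Hx0 Hy0]] [Hy0b Hslice]]]]].
  - assert (Hqp : ball p (s / 2) q) by (apply Hq, ball_center, Ht).
    destruct (subdiff_exists q (s / 2) M (conj_bounded_ball_half p s M q H Hqp)) as [y Hy].
    exists y, q. split; [now apply ball_center|exact Hy].
  - intros y [x [Hx Hy]]. apply (HL x y); auto.
  - exact He.
  - unfold ball in Hx0. pose proof (norm_nonneg u) as Hu.
    (* [w] is the room left around [x0] inside the ball at [q]: less than half goes to the shift by
       [r [*] u], at most half to the new radius [d]. *)
    set (w := t - norm (x0 [-] q)).
    pose (r := w / 2 / (norm u + 1)).
    assert (Hr : 0 < r) by (apply Rdiv_lt_0_compat; unfold w; lra).
    assert (Hru : r * norm u < w / 2).
    { replace (w / 2) with (r * (norm u + 1)) by (unfold r; field; lra).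
      apply Rmult_lt_compat_l; lra. }
    (* Both subgradients being bounded by [L], a displacement below [d] costs at most half of the
       gain [r * (y0 u - b)] in the monotonicity inequality. *)
    pose (d := Rmin (w / 2) (r * (y0 u - b) / (4 * L))).
    assert (Hd1 : d <= w / 2) by apply Rmin_l.
    assert (Hd2 : d <= r * (y0 u - b) / (4 * L)) by apply Rmin_r.
    assert (Hd : 0 < d).
    { apply Rmin_glb_lt; [unfold w; lra|]. apply Rdiv_lt_0_compat; [|lra].
      apply Rmult_lt_0_compat; lra. }
    clearbody d. set (z := x0 [+] r [*] u).
    assert (Hzq : forall x, ball z d x -> ball q t x).
    { apply ball_subset. replace (z [-] q) with (r [*] u [+] (x0 [-] q)) by (unfold z; vfield).
      pose proof (ns_norm_triangle _ (r [*] u) (x0 [-] q)) as H1.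
      rewrite norm_scal_pos in H1 by lra. unfold w in *. lra. }
    exists z, d. split; [exact Hd|]. split; [exact Hzq|].
    assert (Hin : forall x y, ball z d x -> subdiff_X g y x -> y u > b).
    { intros x y Hx Hy. pose proof (subdiff_monotone _ _ _ _ Hy Hy0) as Hmon.
      assert (Hxe : x = x0 [+] r [*] u [+] (x [-] z)) by (unfold z; vfield).
      rewrite Hxe, !dual_add, !dual_scal in Hmon.
      pose proof (HL x y (Hq _ (Hzq _ Hx)) Hy (x [-] z)) as H1.
      pose proof (HL x0 y0 (Hq _ Hx0) Hy0 (x [-] z)) as H2.
      assert (H3 : L * norm (x [-] z) < r * (y0 u - b) / 4).
      { replace (r * (y0 u - b) / 4) with (L * (r * (y0 u - b) / (4 * L))) by (field; lra).
        apply Rmult_lt_compat_l; [lra|]. unfold ball in Hx. lra. }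
      pose proof (Rle_abs (y (x [-] z))). pose proof (Rle_abs (- y0 (x [-] z))) as H4.
      rewrite Rabs_Ropp in H4.
      assert (H5 : r * (y0 u - b) / 2 < r * (y u - b)) by lra.
      assert (0 < r * (y u - b)).
      { apply Rlt_trans with (2 := H5). apply Rdiv_lt_0_compat; [|lra].
        apply Rmult_lt_0_compat; lra. }
      assert (0 < y u - b); [|lra]. apply Rmult_lt_reg_l with r; [exact Hr|lra]. }
    intros x x' y y' Hx Hx' Hy Hy'. apply Hslice.
    + exists x. auto.
    + exists x'. auto.
    + exact (Hin x y Hx Hy).
    + exact (Hin x' y' Hx' Hy').
Qed.

(* If subgradients near x are uniformly close to y, then the conjugate is Fréchet
   differentiable at x with derivative y, and near-maximizers at x are close to y. *)
Lemma near_maximizer_close x y r e d s M : conj_bounded_ball x s M -> 0 < d -> d < s / 2 ->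
  0 < e -> g y = ERfin r -> subdiff_X g y x -> subdiff_small e x d ->
  forall z q, g z = ERfin q -> y x - r - e * (d / 2) <= z x - q ->
  forall v, Rabs (z v - y v) <= 2 * e * norm v.
Proof.
  intros H Hd Hds He Hr Hy Hsm z q Hq Hnear.
  intros v.
  (* On vectors of norm at most [d / 2] the difference is at most [e * d]: half from the slack of
     [z], half from the oscillation of subgradients. *)
  replace (2 * e * norm v) with (e * d / (d / 2) * norm v) by (field; lra).
  replace (z v - y v) with (dual_lin 1 z (-1) y v) by (simpl; ring).
  revert v. apply dual_bound_of_ball; [lra|]. intros v Hv. simpl.
  assert (Hxv : ball x d (x [+] v)).
  { unfold ball. replace (x [+] v [-] x) with v by vfield. lra. }
  assert (Hxv2 : ball x (s / 2) (x [+] v)) by (unfold ball in *; lra).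
  destruct (subdiff_exists (x [+] v) (s / 2) M (conj_bounded_ball_half x s M _ H Hxv2))
    as [w Hw].
  destruct (Hw) as [rw [Hrw _]].
  pose proof (subdiff_conj_ub w _ rw Hrw Hw z q Hq) as H1.
  pose proof (subdiff_conj_ub y x r Hr Hy w rw Hrw) as H2.
  pose proof (Hsm (x [+] v) x w y Hxv (ball_center x d Hd) Hw Hy v) as H3.
  rewrite !dual_add in H1. pose proof (Rle_abs (w v - y v)).
  assert (e * norm v <= e * (d / 2)) by (apply Rmult_le_compat_l; lra).
  lra.
Qed.

(** The exposing vector is [(x, -1)]: on the epigraph its supremum is the value of the conjugate at
    [x], attained over [y]. A maximizing sequence consists of near-maximizers, so its functionals
    tend to [y] by [near_maximizer_close], and its heights converge as differences of convergent
    sequences. *)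
Lemma wstar_exp_of_small x y s M : conj_bounded_ball x s M -> subdiff_X g y x ->
  (forall e, 0 < e -> exists d, 0 < d /\ subdiff_small e x d) -> wstar_exp g y.
Proof.
  intros H Hy Hsm. destruct (Hy) as [r [Hr _]].
  assert (Hub := subdiff_conj_ub y x r Hr Hy).
  assert (Hs : 0 < s) by apply H.
  exists r. split; [exact Hr|]. exists x, (-1).
  assert (Hepi : forall z t, epi g z t -> exists q, g z = ERfin q /\ q <= t).
  { intros z t Hz. unfold epi in Hz. destruct (g z) as [q|]; [|contradiction].
    exists q. auto. }
  assert (Hle : forall v, (exists z t, epi g z t /\ v = z x + t * -1) -> v <= y x - r).
  { intros v [z [t [Hz ->]]]. destruct (Hepi z t Hz) as [q [Hq Hqt]].
    specialize (Hub z q Hq). lra. }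
  assert (Hat : exists z t, epi g z t /\ y x - r = z x + t * -1).
  { exists y, r. split; [|ring]. unfold epi. rewrite Hr. simpl. lra. }
  intros sig Hsig ys ts Hts Hcv.
  assert (Heq : sig = ERfin (y x - r)).
  { destruct sig as [m|].
    - destruct Hsig as [Hm1 Hm2]. f_equal. apply Rle_antisym; [|now apply Hm1].
      apply Rnot_lt_le. intro Hlt. destruct (Hm2 (m - (y x - r))) as [v [Hv1 Hv2]]; [lra|].
      apply Hle in Hv1. lra.
    - destruct (Hsig (y x - r)) as [v [Hv1 Hv2]]. apply Hle in Hv1. lra. }
  subst sig. simpl in Hcv.
  assert (Hys : dual_norm_cv ys y).
  { intros e He. destruct (Hsm (e / 2)) as [d0 [Hd0 Hd0s]]; [lra|].
    set (d := Rmin d0 (s / 3)).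
    assert (Hd1 : d <= d0) by apply Rmin_l.
    assert (Hd2 : d <= s / 3) by apply Rmin_r.
    assert (Hd : 0 < d) by (apply Rmin_glb_lt; lra).
    clearbody d.
    assert (Hds : subdiff_small (e / 2) x d).
    { intros x1 x2 y1 y2 H1 H2. apply Hd0s; unfold ball in *; lra. }
    destruct (Hcv (e / 2 * (d / 2))) as [N HN].
    { apply Rmult_lt_0_compat; lra. }
    exists N. intros n Hn v. specialize (HN n Hn). unfold Rdist in HN.
    apply Rabs_def2 in HN. destruct (Hepi _ _ (Hts n)) as [q [Hq Hqt]].
    replace (e * norm v) with (2 * (e / 2) * norm v) by field.
    apply (near_maximizer_close x y r (e / 2) d s M H Hd ltac:(lra) ltac:(lra) Hr Hy Hds _ q Hq).
    lra. }
  split; [exact Hys|]. intros e He.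
  destruct (Hcv (e / 2)) as [N1 HN1]; [lra|].
  pose proof (norm_nonneg x) as Hx.
  assert (Hd : 0 < e / (2 * (norm x + 1))) by (apply Rdiv_lt_0_compat; lra).
  destruct (Hys _ Hd) as [N2 HN2].
  exists (max N1 N2). intros n Hn. specialize (HN1 n ltac:(lia)). specialize (HN2 n ltac:(lia) x).
  unfold Rdist in *. apply Rabs_def2 in HN1.
  assert (e / (2 * (norm x + 1)) * norm x < e / 2).
  { replace (e / 2) with (e / (2 * (norm x + 1)) * (norm x + 1)) by (field; lra).
    apply Rmult_lt_compat_l; lra. }
  pose proof (Rle_abs (ys n x - y x)). pose proof (Rle_abs (- (ys n x - y x))) as Habs.
  rewrite Rabs_Ropp in Habs. apply Rabs_def1; lra.
Qed.

Context (HX : Banach X).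

Lemma wstar_exp_dense p s M t : conj_bounded_ball p s M -> 0 < t ->
  exists x y, ball p t x /\ subdiff_X g y x /\ wstar_exp g y.
Proof.
  intros H Ht. assert (Hs : 0 < s) by apply H.
  set (t' := Rmin t (s / 2)).
  assert (H1 : t' <= t) by apply Rmin_l.
  assert (H2 : t' <= s / 2) by apply Rmin_r.
  assert (Ht' : 0 < t') by (apply Rmin_glb_lt; lra). clearbody t'.
  destruct (baire HX (fun n x => exists d, 0 < d /\ subdiff_small (/ INR (S n)) x d) p t' Ht')
    as [x [Hx Hsm]].
  - intros n q r Hr Hq.
    destruct (subdiff_small_dense p s M (/ INR (S n)) q r H) as [z [d [Hd [Hz Hzd]]]].
    + apply Rinv_0_lt_compat, lt_0_INR. lia.
    + exact Hr.
    + intros x Hx. apply Hq in Hx. unfold ball in *. lra.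
    + exists z, d. split; [exact Hd|]. intros x Hx. split; [now apply Hz|].
      (* Each point of the ball at [z] inherits the remaining radius, so the whole ball lies in the
         set given to [baire]. *)
      exists (d - norm (x [-] z)). unfold ball in Hx. split; [lra|].
      assert (Hsub : forall w, ball x (d - norm (x [-] z)) w -> ball z d w)
        by (apply ball_subset; lra).
      intros x1 x2 y1 y2 Hx1 Hx2. apply Hzd; now apply Hsub.
  - assert (Hxs : ball p (s / 2) x) by (unfold ball in *; lra).
    assert (Hxb := conj_bounded_ball_half p s M x H Hxs).
    destruct (subdiff_exists x (s / 2) M Hxb) as [y Hy].
    exists x, y. split; [unfold ball in *; lra|]. split; [exact Hy|].
    apply (wstar_exp_of_small x y (s / 2) M Hxb Hy).
    intros e He. destruct (inv_INR_lt e He) as [N HN]. specialize (HN N (le_n N)).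
    destruct (Hsm N) as [d [Hd Hds]]. exists d. split; [exact Hd|].
    intros x1 x2 y1 y2 Hx1 Hx2 Hy1 Hy2 v.
    apply Rle_trans with (1 := Hds x1 x2 y1 y2 Hx1 Hx2 Hy1 Hy2 v).
    apply Rmult_le_compat_r; [apply norm_nonneg|lra].
Qed.

(** If the conjugate were unbounded above on every ball, each set where it exceeds [INR n] would be
    dense, and open by continuity of the witnessing functional. A point common to all of them
    contradicts finiteness. *)
Lemma conj_bounded_ball_exists : wstar_epi_pointed g ->
  exists c s M, conj_bounded_ball c s M.
Proof.
  intros [x0 [d [Hd Hdom]]]. apply NNPP. intro Hno.
  destruct (baire HX (fun n x => exists y r, g y = ERfin r /\ y x - r > INR n) x0 d Hd)
    as [x [Hx Hall]].
  - intros n q t Ht Hq.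
    assert (Hz : exists z y r, ball q t z /\ g y = ERfin r /\ y z > INR n + r).
    { apply NNPP. intro Hn. apply Hno. exists q, t, (INR n). split; [exact Ht|].
      intros z Hz y r Hr. apply Rnot_lt_le. intro. apply Hn. exists z, y, r.
      split; [exact Hz|]. split; [exact Hr|lra]. }
    destruct Hz as [z [y [r [Hz [Hr Hyz]]]]].
    destruct (dual_continuous y z _ Hyz) as [e [He Hye]]. unfold ball in Hz.
    exists z, (Rmin e (t - norm (z [-] q))). split; [apply Rmin_glb_lt; lra|].
    intros x Hx. unfold ball in Hx.
    pose proof (Rmin_l e (t - norm (z [-] q))). pose proof (Rmin_r e (t - norm (z [-] q))).
    split.
    + revert x Hx. apply ball_subset. lra.
    + exists y, r. split; [exact Hr|]. specialize (Hye x ltac:(lra)). lra.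
  - destruct (Hdom x Hx) as [M HM]. destruct (INR_unbounded M) as [n Hn].
    destruct (Hall n) as [y [r [Hr Hy]]]. specialize (HM y r Hr). lra.
Qed.

End Conjugate.

(** * Biconjugation in the weak-star topology *)

(** Vectors of Euclidean [n]-space are functions on [nat] of which only the first [n] values
    count. *)
Fixpoint dot (n : nat) (a b : nat -> R) : R :=
  match n with
  | O => 0
  | S k => dot k a b + a k * b k
  end.

Lemma dot_ext n a b c d : (forall i, (i < n)%nat -> a i = c i) ->
  (forall i, (i < n)%nat -> b i = d i) -> dot n a b = dot n c d.
Proof.
  intros H1 H2. induction n as [|n IH]; simpl; [reflexivity|].
  rewrite IH, H1, H2 by (intros; auto with arith). reflexivity.
Qed.

Lemma dot_square n a t b :
  dot n (fun i => t * a i + (1 - t) * b i) (fun i => t * a i + (1 - t) * b i) =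
  t * t * dot n a a + 2 * t * (1 - t) * dot n a b + (1 - t) * (1 - t) * dot n b b.
Proof. induction n as [|n IH]; simpl; [ring|rewrite IH; ring]. Qed.

(** The midpoint has coefficients [/ 2] and [1 - / 2] to match the convexity hypothesis of
    [separation_from_origin]. *)
Lemma dot_parallelogram n a b :
  dot n (fun i => a i - b i) (fun i => a i - b i) = 2 * dot n a a + 2 * dot n b b -
  4 * dot n (fun i => / 2 * a i + (1 - / 2) * b i) (fun i => / 2 * a i + (1 - / 2) * b i).
Proof. induction n as [|n IH]; simpl; [ring|rewrite IH; field]. Qed.

Lemma dot_nonneg n a : 0 <= dot n a a.
Proof. induction n as [|n IH]; simpl; [lra|]. pose proof (Rle_0_sqr (a n)). unfold Rsqr in *. lra. Qed.

Lemma dot_coord n a i : (i < n)%nat -> a i * a i <= dot n a a.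
Proof.
  induction n as [|n IH]; intro Hi; simpl; [lia|].
  destruct (Nat.eq_dec i n) as [->|].
  - pose proof (dot_nonneg n a). lra.
  - pose proof (Rle_0_sqr (a n)) as H. unfold Rsqr in H. specialize (IH ltac:(lia)). lra.
Qed.

Lemma dot_cv n (u v : nat -> nat -> R) a b :
  (forall i, (i < n)%nat -> Un_cv (fun k => u k i) (a i)) ->
  (forall i, (i < n)%nat -> Un_cv (fun k => v k i) (b i)) ->
  Un_cv (fun k => dot n (u k) (v k)) (dot n a b).
Proof.
  intros Hu Hv. induction n as [|n IH]; simpl.
  - intros e He. exists O. intros. unfold Rdist. rewrite Rminus_diag, Rabs_R0. exact He.
  - apply CV_plus with (An := fun k => dot n (u k) (v k)).
    + apply IH; auto with arith.
    + apply CV_mult with (An := fun k => u k n); auto with arith.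
Qed.

Lemma Un_cv_const c : Un_cv (fun _ => c) c.
Proof. intros e He. exists O. intros. unfold Rdist. rewrite Rminus_diag, Rabs_R0. exact He. Qed.

Lemma Un_cv_ge (u : nat -> R) l c : Un_cv u l -> (forall k, c <= u k) -> c <= l.
Proof.
  intros Hu H. apply Rnot_lt_le. intro Hlt. destruct (Hu (c - l)) as [N HN]; [lra|].
  specialize (HN N (le_n N)). specialize (H N). unfold Rdist in HN.
  apply Rabs_def2 in HN. lra.
Qed.

(* The separating functional is the point of minimal norm in the closure of C. *)
Lemma separation_from_origin n (C : (nat -> R) -> Prop) (d : R) :
  (exists w, C w) ->
  (forall a b t, 0 <= t <= 1 -> C a -> C b -> C (fun i => t * a i + (1 - t) * b i)) ->
  0 < d -> (forall w, C w -> d <= dot n w w) ->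
  exists a k, 0 < k /\ forall w, C w -> k <= dot n a w.
Proof.
  intros [w0 Hw0] Hconv Hd HC.
  destruct (completeness (fun v => exists w, C w /\ v = - dot n w w)) as [D [HD1 HD2]].
  { exists 0. intros v [w [_ ->]]. pose proof (dot_nonneg n w). lra. }
  { exists (- dot n w0 w0). now exists w0. }
  set (q := - D).
  assert (Hq : forall w, C w -> q <= dot n w w).
  { intros w Hw. assert (- dot n w w <= D) by (apply HD1; now exists w). unfold q. lra. }
  assert (Hmin : forall k : nat, exists w, C w /\ dot n w w <= q + / INR (S k)).
  { intro k. apply NNPP. intro Hn.
    assert (0 < / INR (S k)) by (apply Rinv_0_lt_compat, lt_0_INR; lia).
    assert (D <= D - / INR (S k)); [|lra]. apply HD2. intros v [w [Hw ->]].
    apply Rnot_lt_le. intro Hlt. apply Hn. exists w. split; [exact Hw|unfold q; lra]. }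
  pose (u := fun k => proj1_sig (constructive_indefinite_description _ (Hmin k))).
  assert (Hu : forall k, C (u k) /\ dot n (u k) (u k) <= q + / INR (S k)).
  { intro k. exact (proj2_sig (constructive_indefinite_description _ (Hmin k))). }
  clearbody u. clear Hmin.
  (* Midpoints stay in [C], where squared norms are at least [q], so the parallelogram law makes the
     minimizing sequence Cauchy in each coordinate. *)
  assert (Hlim : forall i, exists l, (i < n)%nat -> Un_cv (fun k => u k i) l).
  { intro i. destruct (Nat.le_gt_cases n i) as [Hi|Hi]; [exists 0; lia|].
    destruct (R_complete (fun k => u k i)) as [l Hl]; [|now exists l].
    intros e He. destruct (inv_INR_lt (e * e / 4)) as [N HN].
    { apply Rdiv_lt_0_compat; [|lra]. now apply Rmult_lt_0_compat. }
    exists N. intros j k Hj Hk. unfold Rdist.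
    pose proof (dot_parallelogram n (u j) (u k)) as H1.
    pose proof (dot_coord n (fun i => u j i - u k i) i Hi) as H2. simpl in H2.
    assert (H3 := Hq _ (Hconv (u j) (u k) (/ 2) ltac:(lra) (proj1 (Hu j)) (proj1 (Hu k)))).
    pose proof (proj2 (Hu j)). pose proof (proj2 (Hu k)).
    pose proof (HN j Hj). pose proof (HN k Hk).
    rewrite <- (Rabs_pos_eq e) by lra. apply Rsqr_lt_abs_0. unfold Rsqr. lra. }
  pose (a := fun i => proj1_sig (constructive_indefinite_description _ (Hlim i))).
  assert (Ha : forall i, (i < n)%nat -> Un_cv (fun k => u k i) (a i)).
  { intro i. exact (proj2_sig (constructive_indefinite_description _ (Hlim i))). }
  clearbody a. clear Hlim.
  assert (Haa := dot_cv n u u a a Ha Ha).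
  assert (Had : d <= dot n a a).
  { apply (Un_cv_ge _ _ _ Haa). intro k. apply HC, Hu. }
  assert (Haq : dot n a a <= q).
  { apply le_epsilon. intros e He. destruct (inv_INR_lt (e / 2)) as [N1 HN1]; [lra|].
    destruct (Haa (e / 2)) as [N2 HN2]; [lra|].
    specialize (HN1 (max N1 N2) (Nat.le_max_l _ _)).
    specialize (HN2 (max N1 N2) (Nat.le_max_r _ _)). unfold Rdist in HN2.
    apply Rabs_def2 in HN2. pose proof (proj2 (Hu (max N1 N2))). lra. }
  exists a, d. split; [exact Hd|]. intros w Hw.
  apply Rle_trans with (1 := Had).
  assert (Hseg : forall t, 0 < t <= 1 ->
    q <= dot n (fun i => t * w i + (1 - t) * a i) (fun i => t * w i + (1 - t) * a i)).
  { intros t Ht.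
    assert (Hcv : forall i, (i < n)%nat ->
      Un_cv (fun k => t * w i + (1 - t) * u k i) (t * w i + (1 - t) * a i)).
    { intros i Hi. apply (CV_plus (fun _ => t * w i) (fun k => (1 - t) * u k i)).
      - apply Un_cv_const.
      - apply (CV_mult (fun _ => 1 - t) (fun k => u k i)); [apply Un_cv_const|now apply Ha]. }
    apply (Un_cv_ge _ _ _
      (dot_cv n (fun k i => t * w i + (1 - t) * u k i) (fun k i => t * w i + (1 - t) * u k i)
        (fun i => t * w i + (1 - t) * a i) (fun i => t * w i + (1 - t) * a i) Hcv Hcv)).
    intro k. apply Hq. apply Hconv; [lra|exact Hw|apply Hu]. }
  set (B := dot n w w - 2 * dot n w a + dot n a a).
  assert (Hsym : dot n a w = dot n w a).
  { clear. induction n as [|n IH]; simpl; [reflexivity|rewrite IH; ring]. }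
  rewrite Hsym.
  assert (Ht : forall t, 0 < t <= 1 -> 0 <= 2 * (dot n w a - dot n a a) + t * B).
  { intros t Ht. specialize (Hseg t Ht). rewrite dot_square in Hseg.
    apply Rmult_le_reg_l with t; [lra|]. rewrite Rmult_0_r. unfold B. lra. }
  apply Rnot_lt_le. intro Hlt.
  pose (c := dot n a a - dot n w a).
  pose proof (Rabs_pos B). assert (Hc : 0 < c) by (unfold c; lra).
  (* For this [t] one has [t * B <= c], while [Ht] demands [2 * c <= t * B]. *)
  assert (Ht1 : 0 < c / (c + Rabs B) <= 1).
  { split; [apply Rdiv_lt_0_compat; lra|]. apply Rmult_le_reg_r with (c + Rabs B); [lra|].
    unfold Rdiv. rewrite Rmult_assoc, Rinv_l by lra. lra. }
  specialize (Ht _ Ht1).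
  assert (HcB : c / (c + Rabs B) * B <= c / (c + Rabs B) * (c + Rabs B)).
  { apply Rmult_le_compat_l; [lra|]. pose proof (Rle_abs B). lra. }
  replace (c / (c + Rabs B) * (c + Rabs B)) with c in HcB by (field; lra).
  unfold c in *. lra.
Qed.

Section Biconjugate.

Context {X : NormedSpace} (g : Dual X -> ERbar).

Lemma dual_vcomb (y : Dual X) (env : nat -> X) n c :
  y (vcomb env n c) = dot n c (fun i => y (env i)).
Proof.
  induction n as [|n IH]; simpl; [apply dual_zero|]. now rewrite dual_add, dual_scal, IH.
Qed.

Lemma epi_convex (Hconv : convex_fun g) y z t q a : 0 <= a <= 1 -> epi g y t -> epi g z q ->
  epi g (dual_lin a y (1 - a) z) (a * t + (1 - a) * q).
Proof.
  intros Ha Hy Hz. unfold epi in *.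
  case_eq (g y); [intros ry Hry|intro Hry; rewrite Hry in Hy; contradiction].
  case_eq (g z); [intros rz Hrz|intro Hrz; rewrite Hrz in Hz; contradiction].
  rewrite Hry in Hy. rewrite Hrz in Hz. simpl in Hy, Hz.
  pose proof (Hconv y z (dual_lin a y (1 - a) z) a ry rz Ha Hry Hrz (fun x => eq_refl)) as H.
  destruct (g (dual_lin a y (1 - a) z)) as [r|]; [|contradiction]. simpl in *.
  apply Rle_trans with (1 := H).
  apply Rplus_le_compat; apply Rmult_le_compat_l; lra.
Qed.

(* A basic weak-star neighbourhood depends on finitely many coordinates only, so that the
   separation of a point from the epigraph takes place in a Euclidean space. *)
Lemma biconjugate (Hproper : proper_fun g) (Hconv : convex_fun g) (Hlsc : wstar_lsc g)
  (x0 : X) (m0 : R) (ys : Dual X) (M : R) : conj_ub g x0 m0 ->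
  ~ ER_le (g ys) (ERfin M) -> exists b m, conj_ub g b m /\ ys b - m > M.
Proof.
  intros Hx0 HM.
  destruct (proper_point g Hproper) as [y0 [r0 Hr0]].
  assert (HM' : exists M', M' > M /\ ~ ER_le (g ys) (ERfin M')).
  { destruct (g ys) as [r|]; simpl in *.
    - exists ((M + r) / 2). split; lra.
    - exists (M + 1). split; [lra|tauto]. }
  destruct HM' as [M' [HMM' HM']]. destruct (Hlsc M' ys HM') as [l [e [He Hl]]].
  pose (n := length l). pose (env := fun i => nth i l (ns_zero X)).
  (* Coordinates are centred so that [(ys, M)] becomes the origin; the last one is the height. *)
  pose (W := fun (y : Dual X) (t : R) (i : nat) =>
    if Nat.ltb i n then y (env i) - ys (env i) else t - M).
  destruct (separation_from_origin (S n)
    (fun w => exists y t, epi g y t /\ forall i, w i = W y t i)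
    (Rmin (e * e) ((M' - M) * (M' - M)))) as [a [k [Hk Ha]]].
  - exists (W y0 r0), y0, r0. split; [|reflexivity]. unfold epi. rewrite Hr0. simpl. lra.
  - intros w z t Ht [y [p [Hyp Hw]]] [y' [p' [Hyp' Hz]]].
    exists (dual_lin t y (1 - t) y'), (t * p + (1 - t) * p').
    split; [now apply epi_convex|]. intro i. rewrite Hw, Hz. unfold W. simpl.
    destruct (Nat.ltb i n); ring.
  - apply Rmin_glb_lt; apply Rmult_lt_0_compat; lra.
  - intros w [y [t [Hyt Hw]]].
    (* Either [y] lies in the neighbourhood where [g] exceeds [M'], and the last coordinate is at
       least [M' - M], or one of the others has size at least [e]. *)
    destruct (classic (forall x, In x l -> Rabs (y x - ys x) < e)) as [Hin|Hin].
    + apply Rle_trans with (1 := Rmin_r _ _).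
      apply Rle_trans with (2 := dot_coord (S n) w n (le_n _)).
      rewrite Hw. unfold W. rewrite Nat.ltb_irrefl.
      pose proof (Hl y Hin) as H. unfold epi in Hyt.
      destruct (g y) as [r|]; [|contradiction]. simpl in *.
      apply Rmult_le_compat; lra.
    + apply Rle_trans with (1 := Rmin_l _ _).
      apply not_all_ex_not in Hin. destruct Hin as [x Hx]. apply imply_to_and in Hx.
      destruct Hx as [Hxl Hx]. destruct (In_nth l x (ns_zero X) Hxl) as [i [Hi Hix]].
      apply Rle_trans with (2 := dot_coord (S n) w i ltac:(unfold n; lia)).
      rewrite Hw. unfold W. replace (Nat.ltb i n) with true by (symmetry; now apply Nat.ltb_lt).
      unfold env. rewrite Hix. apply Rnot_lt_le in Hx.
      replace ((y x - ys x) * (y x - ys x)) with (Rabs (y x - ys x) * Rabs (y x - ys x)).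
      * apply Rmult_le_compat; lra.
      * rewrite <- Rabs_mult. apply Rabs_pos_eq. apply Rle_0_sqr.
  - set (v := vcomb env n a). set (s := a n).
    assert (Hsep : forall y t, epi g y t -> k <= y v - ys v + s * (t - M)).
    { intros y t Hyt.
      assert (H := Ha (W y t) (ex_intro _ y (ex_intro _ t (conj Hyt (fun i => eq_refl))))).
      simpl in H. replace (W y t n) with (t - M) in H by (unfold W; now rewrite Nat.ltb_irrefl).
      rewrite (dot_ext n a (W y t) a (fun i => y (env i) - ys (env i))) in H; [|auto|].
      - assert (Hd : dot n a (fun i => y (env i) - ys (env i)) = y v - ys v).
        { unfold v. rewrite !dual_vcomb. clear. induction n as [|n IH]; simpl; [ring|].
          rewrite IH. ring. }
        rewrite Hd in H. exact H.
      - intros i Hi. unfold W. apply Nat.ltb_lt in Hi. now rewrite Hi. }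
    assert (Hsepr : forall y r, g y = ERfin r -> k <= y v - ys v + s * (r - M)).
    { intros y r Hr. apply Hsep. unfold epi. rewrite Hr. simpl. lra. }
    destruct (Rtotal_order s 0) as [Hs|[Hs|Hs]].
    (* A negative [s] is impossible, since the epigraph contains arbitrarily large heights over
       [y0]. *)
    + exfalso. set (c := y0 v - ys v + s * (r0 - M)).
      pose proof (Rle_abs c). pose proof (Rabs_pos c).
      assert (H1 : 0 <= Rabs c / - s).
      { apply Rmult_le_pos; [lra|]. apply Rlt_le, Rinv_0_lt_compat. lra. }
      assert (H2 : epi g y0 (r0 + Rabs c / - s)).
      { unfold epi. rewrite Hr0. simpl. lra. }
      apply Hsep in H2.
      replace (y0 v - ys v + s * (r0 + Rabs c / - s - M)) with (c - Rabs c) in H2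
        by (unfold c; field; lra).
      lra.
    (* The hyperplane is vertical: a multiple of it is added to the affine minorant of [g] given by
       [x0], with [c] large enough to lift the value at [ys] above [M]. *)
    + pose (c := (Rabs (M - ys x0 + m0) + 1) / k).
      assert (Hc : 0 < c).
      { apply Rdiv_lt_0_compat; [|lra]. pose proof (Rabs_pos (M - ys x0 + m0)). lra. }
      exists (x0 [-] c [*] v), (m0 - c * (ys v + k)). split.
      * intros y r Hr. rewrite dual_sub, dual_scal. specialize (Hx0 y r Hr).
        specialize (Hsepr y r Hr). rewrite Hs in Hsepr.
        assert (c * (ys v + k) <= c * y v) by (apply Rmult_le_compat_l; lra). lra.
      * rewrite dual_sub, dual_scal.
        replace (ys x0 - c * ys v - (m0 - c * (ys v + k))) with (ys x0 - m0 + c * k) by ring.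
        unfold c. replace ((Rabs (M - ys x0 + m0) + 1) / k * k) with (Rabs (M - ys x0 + m0) + 1)
          by (field; lra).
        pose proof (Rle_abs (M - ys x0 + m0)). lra.
    (* Dividing by [s] yields an affine minorant of [g] with value [M + k / s] at [ys]. *)
    + exists ((- / s) [*] v), (- / s * ys v - M - k / s).
      assert (His : 0 < / s) by now apply Rinv_0_lt_compat.
      split.
      * intros y r Hr. rewrite dual_scal. specialize (Hsepr y r Hr).
        apply Rmult_le_compat_l with (r := / s) in Hsepr; [|lra].
        replace (/ s * (y v - ys v + s * (r - M))) with (/ s * (y v - ys v) + (r - M)) in Hsepr
          by (field; lra).
        unfold Rdiv. lra.
      * rewrite dual_scal. assert (0 < k / s) by (apply Rdiv_lt_0_compat; lra). lra.
Qed.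

End Biconjugate.

(** * Chains of subgradients *)

Lemma finite_uniform (P : nat -> R -> R -> Prop) (N : nat) :
  (forall i h L h' L', h' <= h -> L <= L' -> P i h L -> P i h' L') ->
  (forall i, (i <= N)%nat -> exists h L, 0 < h /\ P i h L) ->
  exists h L, 0 < h /\ forall i, (i <= N)%nat -> P i h L.
Proof.
  intros Hmono H. induction N as [|N IH].
  - destruct (H O (le_n _)) as [h [L [Hh HP]]]. exists h, L. split; [exact Hh|].
    intros i Hi. now replace i with O by lia.
  - destruct IH as [h [L [Hh HP]]]; [intros; apply H; lia|].
    destruct (H (S N) (le_n _)) as [h' [L' [Hh' HP']]].
    exists (Rmin h h'), (Rmax L L'). split; [now apply Rmin_glb_lt|]. intros i Hi.
    destruct (Nat.eq_dec i (S N)) as [->|].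
    + apply (Hmono _ h' L'); [apply Rmin_r|apply Rmax_r|exact HP'].
    + apply (Hmono _ h L); [apply Rmin_l|apply Rmax_l|apply HP; lia].
Qed.

Section Chains.

Context {X : NormedSpace} (g : Dual X -> ERbar).

Lemma chain_psum_le (xss : nat -> Dual X) (ys : nat -> X) n r0 : g (xss O) = ERfin r0 ->
  (forall i, (i < n)%nat -> subdiff_X g (xss i) (ys i)) ->
  forall r, g (xss n) = ERfin r -> chain_psum xss ys n <= r - r0.
Proof.
  intros H0 H. induction n as [|n IH]; intros r Hr; simpl.
  - rewrite H0 in Hr. injection Hr as <-. lra.
  - destruct (H n (le_n _)) as [q [Hq Hsub]].
    specialize (IH ltac:(intros; apply H; lia) q Hq). specialize (Hsub _ r Hr). lra.
Qed.

Lemma chain_value_le (xss : nat -> Dual X) (ys : nat -> X) n r0 xs r : g (xss O) = ERfin r0 ->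
  (forall i, (i <= n)%nat -> subdiff_X g (xss i) (ys i)) -> g xs = ERfin r ->
  chain_value xss ys n xs <= r - r0.
Proof.
  intros H0 H Hr. destruct (H n (le_n _)) as [q [Hq Hsub]].
  pose proof (chain_psum_le xss ys n r0 H0 ltac:(intros; apply H; lia) q Hq).
  specialize (Hsub xs r Hr). unfold chain_value. lra.
Qed.

Lemma subdiff_step x y x' y' r r' : g y = ERfin r -> g y' = ERfin r' -> subdiff_X g y' x' ->
  y (x' [-] x) <= (y' x' - r') - (y x - r).
Proof.
  intros Hr Hr' Hy'. pose proof (subdiff_conj_ub g y' x' r' Hr' Hy' y r Hr) as H.
  rewrite dual_sub. lra.
Qed.

(* Writing f for the conjugate, each increment is f(x_(i+1)) - f(x_i) up to replacing the
   step x_(i+1) - x_i by the next one x_(i+2) - x_(i+1), at which the subgradient inequality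
   at x_(i+1) has the right direction. *)
Lemma chain_psum_ge (xss : nat -> Dual X) (ys : nat -> X) (gv : nat -> R) N L h :
  (forall i, (i <= N)%nat -> g (xss i) = ERfin (gv i)) ->
  (forall i, (i <= N)%nat -> subdiff_X g (xss i) (ys i)) ->
  (forall i v, (1 <= i <= N)%nat -> Rabs (xss i v) <= L * norm v) -> 0 <= L ->
  (forall i, (i + 2 <= N)%nat ->
     norm ((ys (S i) [-] ys i) [-] (ys (S (S i)) [-] ys (S i))) <= 4 * h) ->
  let f i := xss i (ys i) - gv i in
  forall k, (S k <= N)%nat ->
  (f 1%nat - f O) - (f (S k) - f k) + gv k - gv O - INR k * (4 * L * h) <= chain_psum xss ys k.
Proof.
  intros Hg Hsub HL HL0 Hdiff f k. induction k as [|k IH]; intro Hk.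
  - simpl. lra.
  - specialize (IH ltac:(lia)). rewrite S_INR. cbn [chain_psum].
    pose proof (subdiff_step (ys (S k)) (xss (S k)) (ys (S (S k))) (xss (S (S k))) _ _
      (Hg (S k) ltac:(lia)) (Hg (S (S k)) Hk) (Hsub _ Hk)) as H1.
    pose proof (HL (S k) ((ys (S k) [-] ys k) [-] (ys (S (S k)) [-] ys (S k))) ltac:(lia)) as H2.
    assert (H3 := Hdiff k ltac:(lia)).
    apply Rmult_le_compat_l with (r := L) in H3; [|exact HL0].
    pose proof (Rle_abs (xss (S k) ((ys (S k) [-] ys k) [-] (ys (S (S k)) [-] ys (S k))))) as H4.
    rewrite !dual_sub in *. unfold f in *. lra.
Qed.

Context (Hproper : proper_fun g) (Hlsc : wstar_lsc g) (HRNP : RNP_dual X) (HX : Banach X).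

(** The total error is at most [E * / INR N + F * h]. [E] involves only the bounds for [x0s] and
    near [b], and determines [N]; the bound [L], and with it [F], may depend on [N], so [h] comes
    last. *)
Lemma chain_exists (x0s : Dual X) (x0 b : X) (r0 s m e : R) (xs : Dual X) :
  g x0s = ERfin r0 -> subdiff_X g x0s x0 -> conj_bounded_ball g b s m -> 0 < e ->
  exists (n : nat) (xss : nat -> Dual X) (ys : nat -> X), xss O = x0s /\
    (forall i, (1 <= i <= n)%nat -> wstar_exp g (xss i)) /\
    (forall i, (i <= n)%nat -> subdiff_X g (xss i) (ys i)) /\
    chain_value xss ys n xs > xs b - m - r0 - e.
Proof.
  intros Hr0 Hx0 Hb He.
  destruct (subdiff_locally_bounded g Hproper b s m Hb) as [Lb [HLb0 HLb]].
  destruct (dual_bound_pos xs) as [C [HC0 HC]].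
  destruct (dual_bound_pos x0s) as [C0 [HC00 HC0x]].
  pose (E := (Lb + C0) * norm (b [-] x0)).
  assert (HE : 0 <= E) by (apply Rmult_le_pos; [lra|apply norm_nonneg]).
  destruct (inv_INR_lt (e / (2 * (E + 1)))) as [n Hn]; [apply Rdiv_lt_0_compat; lra|].
  specialize (Hn n (le_n n)). set (N := S n) in *.
  assert (HN : 0 < INR N) by (apply lt_0_INR; unfold N; lia).
  assert (HEN : E * / INR N < e / 2).
  { apply Rle_lt_trans with (E * (e / (2 * (E + 1)))).
    - apply Rmult_le_compat_l; lra.
    - apply Rlt_le_trans with ((E + 1) * (e / (2 * (E + 1)))).
      + apply Rmult_lt_compat_r; [apply Rdiv_lt_0_compat|]; lra.
      + right. field. lra. }
  pose (p := fun i => x0 [+] (INR i * / INR N) [*] (b [-] x0)).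
  assert (Hfrac : forall i, (1 <= i <= N)%nat -> 0 < INR i * / INR N <= 1).
  { intros i Hi. assert (0 < INR i) by (apply lt_0_INR; lia).
    assert (INR i <= INR N) by (apply le_INR; lia).
    assert (0 < / INR N) by now apply Rinv_0_lt_compat. split.
    - now apply Rmult_lt_0_compat.
    - apply Rmult_le_reg_r with (INR N); [lra|]. rewrite Rmult_assoc, Rinv_l by lra. lra. }
  assert (Hpb : p N = b).
  { unfold p. rewrite Rinv_r by lra. vfield. }
  (* Index 0 is excluded: no ball of boundedness around [x0] is available. *)
  assert (Hball : forall i, (1 <= i <= N)%nat -> exists t M, conj_bounded_ball g (p i) t M).
  { intros i Hi. do 2 eexists.
    exact (conj_bounded_ball_segment g x0 (x0s x0 - r0) b s m _
      (subdiff_conj_ub g x0s x0 r0 Hr0 Hx0) Hb (Hfrac i Hi)). }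
  destruct (finite_uniform (fun i h L => (1 <= i)%nat -> forall x y, ball (p i) h x ->
    subdiff_X g y x -> forall v, Rabs (y v) <= L * norm v) N) as [h0 [L0 [Hh0 HL0]]].
  { intros i h L h' L' Hh HL H Hi x y Hx Hy v. apply Rle_trans with (L * norm v).
    - apply (H Hi x y); [unfold ball in *; lra|exact Hy].
    - apply Rmult_le_compat_r; [apply norm_nonneg|exact HL]. }
  { intros i HiN. destruct (Nat.eq_dec i 0) as [->|Hi0].
    - exists 1, 0. split; [lra|]. intro. lia.
    - destruct (Hball i ltac:(lia)) as [t [M Ht]].
      destruct (subdiff_locally_bounded g Hproper _ _ _ Ht) as [L [HL1 HL2]].
      exists (t / 2), L. split; [destruct Ht; lra|]. intros _ x y. apply HL2. }
  set (L := Rmax L0 1). assert (HL1 : 1 <= L) by apply Rmax_r.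
  (* [C] pays for moving [ys N] to [b] under [xs], [C0] for the first step, [3 * Lb] for the last
     step (twice) and the value of the conjugate at [ys N] (once), the final summand for the errors
     in [chain_psum_ge]. *)
  pose (F := C + C0 + 3 * Lb + INR N * (4 * L)).
  assert (HF : 0 < F).
  { assert (0 < INR N * (4 * L)) by (apply Rmult_lt_0_compat; lra). unfold F. lra. }
  pose (h := Rmin (Rmin h0 (s / 2)) (e / (4 * F))).
  assert (Hhh0 : h <= h0) by (apply Rle_trans with (1 := Rmin_l _ _); apply Rmin_l).
  assert (Hhs : h <= s / 2) by (apply Rle_trans with (1 := Rmin_l _ _); apply Rmin_r).
  assert (HhF : F * h < e / 2).
  { apply Rle_lt_trans with (F * (e / (4 * F))).
    - apply Rmult_le_compat_l; [lra|apply Rmin_r].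
    - replace (F * (e / (4 * F))) with (e / 4) by (field; lra). lra. }
  assert (Hh : 0 < h).
  { destruct Hb. repeat apply Rmin_glb_lt; try lra. apply Rdiv_lt_0_compat; lra. }
  clearbody h.
  assert (Hch : forall i, exists q : Dual X * X, (1 <= i <= N)%nat ->
    ball (p i) h (snd q) /\ subdiff_X g (fst q) (snd q) /\ wstar_exp g (fst q)).
  { intro i. destruct (classic (1 <= i <= N)%nat) as [Hi|Hi]; [|exists (x0s, x0); tauto].
    destruct (Hball i Hi) as [t [M Ht]].
    destruct (wstar_exp_dense g Hproper Hlsc HRNP HX _ _ _ h Ht Hh) as [x [y Hxy]].
    exists (y, x). intros _. exact Hxy. }
  pose (q := fun i => proj1_sig (constructive_indefinite_description _ (Hch i))).
  assert (Hq : forall i, (1 <= i <= N)%nat ->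
    ball (p i) h (snd (q i)) /\ subdiff_X g (fst (q i)) (snd (q i)) /\ wstar_exp g (fst (q i))).
  { intro i. exact (proj2_sig (constructive_indefinite_description _ (Hch i))). }
  clearbody q. clear Hch.
  pose (xss := fun i => match i with O => x0s | S _ => fst (q i) end).
  pose (ys := fun i => match i with O => x0 | S _ => snd (q i) end).
  assert (Hsub : forall i, (i <= N)%nat -> subdiff_X g (xss i) (ys i)).
  { intros [|i] Hi; [exact Hx0|]. apply Hq. lia. }
  assert (Hnear : forall i, (i <= N)%nat -> norm (ys i [-] p i) <= h).
  { intros [|i] Hi.
    - replace (p O) with x0 by (unfold p; change (INR 0) with 0; vfield; lra).
      simpl. rewrite norm_sub_self. lra.
    - apply Rlt_le. apply (Hq (S i)). lia. }
  exists N, xss, ys. split; [reflexivity|].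
  split. { intros [|i] Hi; [lia|]. apply Hq. lia. }
  split; [exact Hsub|].
  assert (Hgv : forall i, exists r, (i <= N)%nat -> g (xss i) = ERfin r).
  { intro i. destruct (classic (i <= N)%nat) as [Hi|Hi]; [|exists 0; tauto].
    destruct (Hsub i Hi) as [r [Hr _]]. now exists r. }
  pose (gv := fun i => proj1_sig (constructive_indefinite_description _ (Hgv i))).
  assert (Hg : forall i, (i <= N)%nat -> g (xss i) = ERfin (gv i)).
  { intro i. exact (proj2_sig (constructive_indefinite_description _ (Hgv i))). }
  clearbody gv. clear Hgv.
  assert (Hg0 : gv O = r0).
  { specialize (Hg O ltac:(lia)). simpl in Hg. rewrite Hr0 in Hg. now injection Hg. }
  assert (HLx : forall i v, (1 <= i <= N)%nat -> Rabs (xss i v) <= L * norm v).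
  { intros [|i] v Hi; [lia|]. apply Rle_trans with (L0 * norm v).
    - apply (HL0 (S i)) with (x := snd (q (S i))); try lia; [|apply Hq; lia].
      destruct (Hq (S i) Hi) as [H1 _]. unfold ball in *. lra.
    - apply Rmult_le_compat_r; [apply norm_nonneg|apply Rmax_l]. }
  assert (Hdiff : forall i, (i + 2 <= N)%nat ->
    norm ((ys (S i) [-] ys i) [-] (ys (S (S i)) [-] ys (S i))) <= 4 * h).
  { intros i Hi.
    (* Second differences of [p] vanish, so only the deviations from [p] remain, with weights 2, 1
       and 1. *)
    replace ((ys (S i) [-] ys i) [-] (ys (S (S i)) [-] ys (S i)))
      with ((2 [*] (ys (S i) [-] p (S i)) [+] (p i [-] ys i)) [+] (p (S (S i)) [-] ys (S (S i))))
      by (unfold p; rewrite !S_INR; vfield; lra).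
    apply Rle_trans with (1 := ns_norm_triangle _ _ _).
    pose proof (ns_norm_triangle _ (2 [*] (ys (S i) [-] p (S i))) (p i [-] ys i)) as H1.
    rewrite norm_scal_pos in H1 by lra.
    rewrite (norm_sub_sym (p i)) in H1. rewrite (norm_sub_sym (p (S (S i)))).
    pose proof (Hnear i ltac:(lia)). pose proof (Hnear (S i) ltac:(lia)).
    pose proof (Hnear (S (S i)) ltac:(lia)). lra. }
  pose proof (chain_psum_ge xss ys gv N L h Hg Hsub HLx ltac:(lra) Hdiff n (le_n _)) as Hsum.
  cbv beta zeta in Hsum.
  assert (HNb : norm (ys N [-] b) <= h) by (rewrite <- Hpb at 1; apply Hnear, le_n).
  assert (HLN : forall v, Rabs (xss N v) <= Lb * norm v).
  { apply (HLb (ys N)); [|apply Hsub, le_n].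
    destruct (Hq N ltac:(unfold N; lia)) as [H1 _]. rewrite Hpb in H1.
    unfold ball in *. change (ys N) with (snd (q N)). lra. }
  (* The first increment needs only a lower bound, which the subgradient [x0s] supplies even at a
     boundary point. *)
  assert (H1 : x0s (ys 1%nat [-] x0) <= (xss 1%nat (ys 1%nat) - gv 1%nat) - (x0s x0 - r0)).
  { apply subdiff_step; [exact Hr0|apply Hg; unfold N; lia|apply Hsub; unfold N; lia]. }
  assert (H2 : - (C0 * (norm (b [-] x0) * / INR N + h)) <= x0s (ys 1%nat [-] x0)).
  { assert (Hy : norm (ys 1%nat [-] x0) <= norm (b [-] x0) * / INR N + h).
    { replace (ys 1%nat [-] x0) with (/ INR N [*] (b [-] x0) [+] (ys 1%nat [-] p 1%nat))
        by (unfold p; change (INR 1) with 1; vfield; lra).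
      apply Rle_trans with (1 := ns_norm_triangle _ _ _).
      rewrite norm_scal_pos by (apply Rlt_le, Rinv_0_lt_compat, HN).
      pose proof (Hnear 1%nat ltac:(unfold N; lia)). lra. }
    apply Rmult_le_compat_l with (r := C0) in Hy; [|lra].
    pose proof (HC0x (ys 1%nat [-] x0)) as H2. pose proof (Rle_abs (- x0s (ys 1%nat [-] x0))) as H3.
    rewrite Rabs_Ropp in H3. lra. }
  assert (H3 : xss N (ys N [-] ys n) <= Lb * (norm (b [-] x0) * / INR N + 2 * h)).
  { assert (Hy : norm (ys N [-] ys n) <= norm (b [-] x0) * / INR N + 2 * h).
    { replace (ys N [-] ys n)
        with (/ INR N [*] (b [-] x0) [+] (ys N [-] p N) [+] (p n [-] ys n)).
      2:{ unfold p. replace (INR N * / INR N) with (/ INR N + INR n * / INR N)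
            by (unfold N; rewrite S_INR; field; rewrite <- S_INR; apply not_0_INR; lia).
          vfield. }
      apply Rle_trans with (1 := ns_norm_triangle _ _ _).
      pose proof (ns_norm_triangle _ (/ INR N [*] (b [-] x0)) (ys N [-] p N)) as H3.
      rewrite norm_scal_pos in H3 by (apply Rlt_le, Rinv_0_lt_compat, HN).
      rewrite (norm_sub_sym (p n)).
      pose proof (Hnear n ltac:(unfold N; lia)). pose proof (Hnear N (le_n _)). lra. }
    apply Rmult_le_compat_l with (r := Lb) in Hy; [|lra].
    pose proof (HLN (ys N [-] ys n)). pose proof (Rle_abs (xss N (ys N [-] ys n))). lra. }
  assert (H4 : xss N (ys N) - gv N <= m + Lb * h).
  { destruct Hb as [Hs Hb]. pose proof (Hb b (ball_center b s Hs) _ _ (Hg N (le_n _))) as H4.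
    pose proof (HLN (ys N [-] b)) as H5. pose proof (Rle_abs (xss N (ys N [-] b))) as H6.
    apply Rmult_le_compat_l with (r := Lb) in HNb; [|lra]. rewrite dual_sub in *. lra. }
  assert (H5 : xs b - C * h <= xs (ys N)).
  { pose proof (HC (ys N [-] b)) as H5. pose proof (Rle_abs (- xs (ys N [-] b))) as H6.
    rewrite Rabs_Ropp in H6.
    apply Rmult_le_compat_l with (r := C) in HNb; [|lra]. rewrite dual_sub in *. lra. }
  assert (H6 : INR n * (4 * L * h) <= INR N * (4 * L * h)).
  { apply Rmult_le_compat_r; [repeat apply Rmult_le_pos; lra|].
    apply le_INR. unfold N. lia. }
  assert (Hval : chain_value xss ys N xs = chain_psum xss ys n +
    (xss N (ys n) - xss n (ys n)) + (xs (ys N) - xss N (ys N))) by reflexivity.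
  rewrite Hval. rewrite dual_sub in H3. fold N in Hsum. rewrite Hg0 in Hsum.
  change (xss O (ys O)) with (x0s x0) in Hsum.
  unfold E in HEN. unfold F in HhF. lra.
Qed.

End Chains.

(** Biconjugation yields [b0] merely in the domain of the conjugate, while the chain must end at the
    centre of a ball of boundedness. The inequality for [T] is strict, so [b0] can be moved slightly
    towards [c]. *)
Lemma interior_target {X : NormedSpace} (g : Dual X -> ERbar) (b0 c : X) (m0 s M T : R)
  (xs : Dual X) : conj_ub g b0 m0 -> conj_bounded_ball g c s M -> xs b0 - m0 > T ->
  exists b t m, conj_bounded_ball g b t m /\ xs b - m > T.
Proof.
  intros Hb0 Hc HT. pose (d := Rabs ((xs c - xs b0) - (M - m0))).
  assert (Hd : 0 <= d) by apply Rabs_pos.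
  pose (w := xs b0 - m0 - T). assert (Hw : 0 < w) by (unfold w; lra).
  (* This fraction makes the loss [t * d] smaller than the margin [w]. *)
  pose (t := w / (w + d)).
  assert (Ht : 0 < t <= 1).
  { split; [apply Rdiv_lt_0_compat; lra|]. apply Rmult_le_reg_r with (w + d); [lra|].
    unfold t, Rdiv. rewrite Rmult_assoc, Rinv_l by lra. lra. }
  assert (Htd : t * d < w).
  { apply Rlt_le_trans with (t * (w + d)).
    - apply Rmult_lt_compat_l; lra.
    - unfold t. right. field. lra. }
  exists (b0 [+] t [*] (c [-] b0)), (t * s), ((1 - t) * m0 + t * M).
  split; [now apply conj_bounded_ball_segment|].
  rewrite dual_add, dual_scal, dual_sub.
  pose proof (Rle_abs (- ((xs c - xs b0) - (M - m0)))) as H. rewrite Rabs_Ropp in H. fold d in H.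
  apply Rmult_le_compat_l with (r := t) in H; [|lra]. unfold w in Htd. lra.
Qed.

Theorem mainTheorem13 (X : NormedSpace) (HX : Banach X) (HRNP : RNP_dual X)
    (g : Dual X -> ERbar)
    (Hproper : proper_fun g) (Hconv : convex_fun g) (Hlsc : wstar_lsc g)
    (Hpointed : wstar_epi_pointed g)
    (x0s : Dual X) (Hx0s : exists x : X, subdiff_X g x0s x)
    (r0 : R) (Hr0 : g x0s = ERfin r0) (xs : Dual X) :
  is_sup_ER
    (fun v => exists (n : nat) (xss : nat -> Dual X) (ys : nat -> X),
        xss 0%nat = x0s /\
        (forall i, (1 <= i <= n)%nat -> wstar_exp g (xss i)) /\
        (forall i, (i <= n)%nat -> subdiff_X g (xss i) (ys i)) /\
        v = chain_value xss ys n xs)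
    (ER_minus (g xs) r0).
Proof.
  destruct Hx0s as [x0 Hx0].
  (* The negated [ER_le] serves both cases: [T = r - e] for a finite value of [g xs], [T = M + r0]
     for an infinite one. *)
  assert (Hmain : forall T, ~ ER_le (g xs) (ERfin T) -> exists v,
    (exists (n : nat) (xss : nat -> Dual X) (ys : nat -> X),
        xss 0%nat = x0s /\
        (forall i, (1 <= i <= n)%nat -> wstar_exp g (xss i)) /\
        (forall i, (i <= n)%nat -> subdiff_X g (xss i) (ys i)) /\
        v = chain_value xss ys n xs) /\ v > T - r0).
  { intros T HT.
    destruct (biconjugate g Hproper Hconv Hlsc x0 (x0s x0 - r0) xs T
      (subdiff_conj_ub g x0s x0 r0 Hr0 Hx0) HT) as [b0 [m0 [Hb0 HT0]]].
    destruct (conj_bounded_ball_exists g HX Hpointed) as [c [s [M Hc]]].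
    destruct (interior_target g b0 c m0 s M T xs Hb0 Hc HT0) as [b [t [m [Hb HbT]]]].
    destruct (chain_exists g Hproper Hlsc HRNP HX x0s x0 b r0 t m (xs b - m - T) xs
      Hr0 Hx0 Hb ltac:(lra)) as [n [xss [ys [H1 [H2 [H3 H4]]]]]].
    exists (chain_value xss ys n xs). split; [now exists n, xss, ys|lra]. }
  case_eq (g xs); [intros r Hr|intro Hr]; rewrite Hr in Hmain; simpl in *.
  - split.
    + intros v [n [xss [ys [H0 [_ [Hsub ->]]]]]].
      apply (chain_value_le g); [now rewrite H0|exact Hsub|exact Hr].
    + intros e He. destruct (Hmain (r - e)) as [v [Hv HvT]]; [lra|].
      exists v. split; [exact Hv|lra].
  - intro M. destruct (Hmain (M + r0)) as [v [Hv HvT]]; [tauto|].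
    exists v. split; [exact Hv|lra].
Qed.
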